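(* Let $k\in L^1_{\mathrm{loc}}([0,\infty))$ be nonnegative, non-increasing and right-continuous with $\lim_{s\to\infty}k(s)=0$. Then $D(\Lambda^k,\mathcal H)\subset\mathcal F^k$ and for all $u\in D(\Lambda^k,\mathcal H)$ $$\Lambda^ku=-\frac{\mathrm d}{\mathrm dt}(k*u).$$
   Context: Setting. $H$ is a real separable Hilbert space identified with its dual; $V$ is a real reflexive Banach space continuously and densely embedded into $H$, so $V\subseteq H\cong H^*\subseteq V^*$. An exponent $\alpha\in(1,\infty)$ is fixed. $\mathcal V=L^\alpha([0,\infty);V)\cap L^2([0,\infty);H)$ with norm the maximum of the two norms, $\mathcal H=L^2([0,\infty);H)$, and $\mathcal V^*=L^{\alpha/(\alpha-1)}([0,\infty);V^* )+L^2([0,\infty);H)$ with the norm $\|u\|_{\mathcal V^*}=\inf\{\|u_1\|_{L^{\alpha/(\alpha-1)}([0,\infty);V^* )}+\|u_2\|_{\mathcal H}: u=u_1+u_2\}$. Functions on $[0,\infty)$ are extended by $0$ to $(-\infty,0)$. Generator. $M^k$ is the unique measure on $(0,\infty)$ with $k(s)=M^k((s,\infty))$ for $s\in(0,\infty)$ (so $\int_{(0,\infty)}(\tau\wedge1)M^k(\mathrm d\tau)<\infty$), and $\psi^k(\lambda):=\int_{(0,\infty)}(1-e^{-\lambda\tau})M^k(\mathrm d\tau)$. For $t\ge0$, $\mu_t^k$ is the unique probability measure on $[0,\infty)$ with $\int_{[0,\infty)}e^{-\lambda s}\mu_t^k(\mathrm ds)=e^{-t\psi^k(\lambda)}$, $\lambda>0$.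 With $U_sf(r):=\mathbf 1_{[0,\infty)}(r-s)f(r-s)$, $r\ge0$, put $U_t^kf:=\int_{[0,\infty)}U_sf\,\mu_t^k(\mathrm ds)=f*\mu_t^k$, $f\in\mathcal H$; this is a $C_0$-semigroup of contractions on $\mathcal H$, and $\Lambda^k$ with domain $D(\Lambda^k,\mathcal H)$ is its infinitesimal generator. The semigroup restricts to a $C_0$-semigroup on $\mathcal V$. The space $\mathcal F^k$. The operator $\Lambda^k:D(\Lambda^k,\mathcal H)\cap\mathcal V\to\mathcal V^*$ is closable as an operator from $\mathcal V$ to $\mathcal V^*$; its closure is again denoted $\Lambda^k$, and $\mathcal F^k$ is the domain of this closure, a Banach space with norm $\|u\|_{\mathcal F^k}=(\|u\|_{\mathcal V}^2+\|\Lambda^ku\|_{\mathcal V^*}^2)^{1/2}$. Convolution. $(k*u)(t)=\int_0^tk(t-s)u(s)\,\mathrm ds$, and $\frac{\mathrm d}{\mathrm dt}$ is understood in the weak sense.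
   Formalization: The inclusion is proved as D(Λ^k,𝓗)∩𝓥 ⊂ F^k: as written it fails, e.g. for k=0, V=H=ℝ, α=4, where D(Λ^k,𝓗)=L² is not contained in F^k=L⁴∩L². The formula for Λ^k u is proved for all u in D(Λ^k,𝓗). *)

(* Defs.v *)
From HB Require Import structures.
From mathcomp Require Import all_boot all_order all_algebra.
From mathcomp Require Import all_classical all_reals all_analysis.
From mathcomp Require Import ring lra.

Set Implicit Arguments.
Unset Strict Implicit.
Unset Printing Implicit Defensive.
Import Order.TTheory GRing.Theory Num.Theory.
Import numFieldNormedType.Exports.
Local Open Scope classical_set_scope.
Local Open Scope ring_scope.

Section Dual.
Context {R : realType} {V : normedModType R}.

Definition dual_pred : {pred V -> R^o} :=
  mem [set f : V -> R^o | linear f /\ continuous f].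
Definition dual_key : pred_key dual_pred. Proof. exact. Qed.
Canonical dual_keyed := KeyedPred dual_key.

Lemma dual_submod : submod_closed dual_pred.
Proof.
split.
  rewrite inE; split; last exact: cst_continuous.
  by move=> a x y; rewrite /GRing.zero /= scaler0 addr0.
move=> a f g /[!inE] -[lf cf] [lg cg]; split.
  move=> b x y; change (a *: f (b *: x + y) + g (b *: x + y) =
     b *: (a *: f x + g x) + (a *: f y + g y)).
  by rewrite lf lg /GRing.scale /=; ring.
by move=> x; apply: cvgD; [apply: cvgZr; exact: cf|exact: cg].
Qed.

HB.instance Definition _ :=
  GRing.isSubmodClosed.Build _ _ dual_pred dual_submod.
End Dual.

Record dual {R : realType} (V : normedModType R) :=
  Dual { dual_fun :> V -> R^o ; _ : dual_fun \in dual_pred }.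

Section DualNormed.
Context {R : realType} {V : normedModType R}.
Implicit Types phi : dual V.

HB.instance Definition _ := [isSub for @dual_fun R V].
HB.instance Definition _ := [Choice of dual V by <:].
HB.instance Definition _ := [SubChoice_isSubLmodule of dual V by <:].

Lemma dualP phi : linear phi /\ continuous phi.
Proof. by have := valP phi; rewrite inE. Qed.

Definition dual_norm phi : R :=
  sup [set `|phi v| | v in [set v : V | `|v| <= 1]].

Lemma dual_norm_has_sup phi :
  has_sup [set `|phi v| | v in [set v : V | `|v| <= 1]].
Proof.
have [lf cf] := dualP phi; split; first by exists `|phi 0|, 0; rewrite //= normr0.
pose L := GRing.isLinear.Build R V R^o *:%R phi lf.
pose f : {linear V -> R^o} := HB.pack (phi : V -> R^o) L.
have /linear_boundedP : bounded_near f (nbhs (0 : V)).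
  by apply: continuous_linear_bounded; exact: cf.
move=> /pinfty_ex_gt0 [M M0 HM]; exists M => _ /= [v v1 <-].
by rewrite (le_trans (HM v)) // ler_piMr // ltW.
Qed.

Lemma dual_norm_ub phi v : `|v| <= 1 -> `|phi v| <= dual_norm phi.
Proof.
by move=> v1; apply: (sup_upper_bound (dual_norm_has_sup phi)); exists v.
Qed.

Lemma dual_norm_le phi M :
  (forall v, `|v| <= 1 -> `|phi v| <= M) -> dual_norm phi <= M.
Proof.
move=> H; apply: ge_sup; last by move=> _ [v /= v1 <-]; exact: H.
by have [] := dual_norm_has_sup phi.
Qed.

Lemma dual_normD phi psi : dual_norm (phi + psi) <= dual_norm phi + dual_norm psi.
Proof.
apply: dual_norm_le => v v1.
change (`|phi v + psi v| <= dual_norm phi + dual_norm psi).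
by rewrite (le_trans (ler_normD _ _)) // lerD // dual_norm_ub.
Qed.

Let dual_normZ_le a phi : dual_norm (a *: phi) <= `|a| * dual_norm phi.
Proof.
apply: dual_norm_le => v v1.
change (`|a * phi v| <= `|a| * dual_norm phi).
by rewrite normrM ler_wpM2l // dual_norm_ub.
Qed.

Lemma dual_normZ a phi : dual_norm (a *: phi) = `|a| * dual_norm phi.
Proof.
apply/eqP; rewrite eq_le dual_normZ_le /=.
have [->|a0] := eqVneq a 0.
  rewrite normr0 mul0r.
  by rewrite (le_trans _ (dual_norm_ub (0 *: phi) (v := 0) _)) ?normr0.
have := dual_normZ_le a^-1 (a *: phi).
by rewrite scalerA mulVf // scale1r normfV ler_pdivlMl // normr_gt0.
Qed.

Lemma dual_norm0_eq0 phi : dual_norm phi = 0 -> phi = 0.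
Proof.
move=> p0; apply/val_inj/funext => v; change (phi v = 0).
have [lf _] := dualP phi.
have lZ a x : phi (a *: x) = a * phi x.
  have l0 : phi 0 = 0.
    by have := lf (-1) 0 0; rewrite scaler0 addr0 scaleN1r addNr.
  by have := lf a x 0; rewrite !addr0 l0 addr0.
have [->|v0] := eqVneq v 0; first by have := lZ 0 0; rewrite scale0r mul0r.
have nv : `|v| != 0 by rewrite normr_eq0.
have := @dual_norm_ub phi (`|v|^-1 *: v).
rewrite p0 normrZ normfV normr_id mulVf // lexx => /(_ isT).
rewrite normr_le0 lZ mulf_eq0 invr_eq0 (negbTE nv) /=.
by move/eqP.
Qed.

HB.instance Definition _ := Lmodule_isNormed.Build R (dual V)
  dual_normD dual_normZ dual_norm0_eq0.

End DualNormed.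

Definition reflexive_space {R : realType} (V : normedModType R) :=
  forall F : dual (dual V), exists v : V, forall phi : dual V, F phi = phi v.

Definition separable_space (T : topologicalType) :=
  exists2 A : set T, countable A & dense A.

(* A real Hilbert space is a complete normed space [H] with an
   [inner_product H], i.e. an inner product inducing its norm. *)

Record inner_product {R : realType} (H : normedModType R) := InnerProduct {
  ip_fun :> H -> H -> R ;
  ipC : forall x y, ip_fun x y = ip_fun y x ;
  ip_linear : forall z a x y,
    ip_fun z (a *: x + y) = a * ip_fun z x + ip_fun z y ;
  ip_norm : forall x, ip_fun x x = `|x| ^+ 2 }.

Section Embedding.
Context {R : realType} {V H : normedModType R}.
Variables (ip : inner_product H) (iota : {linear V -> H}).

Lemma ip0 z : ip z 0 = 0.
Proof.
have := ip_linear ip z (-1) 0 0; rewrite scaler0 addr0 mulN1r => ->.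
by rewrite addNr.
Qed.

Lemma ipZ z a x : ip z (a *: x) = a * ip z x.
Proof. by rewrite -[a *: x]addr0 ip_linear ip0 addr0. Qed.

Lemma cauchy_schwarz x y : `|ip x y| <= `|x| * `|y|.
Proof.
have [->|y0] := eqVneq y 0; first by rewrite ip0 !normr0 mulr0.
have ny : 0 < `|y| ^+ 2 by rewrite exprn_gt0 // normr_gt0.
pose c := ip x y / `|y| ^+ 2.
have cy : c * `|y| ^+ 2 = ip x y by rewrite /c divfK // gt_eqF.
have : 0 <= ip ((- c) *: y + x) ((- c) *: y + x) by rewrite ip_norm sqr_ge0.
rewrite ip_linear ![ip (_ + _) _]ipC !ip_linear [ip y x]ipC !ip_norm => h.
have {}h : c * ip x y <= `|x| ^+ 2 by nra.
have h2 : ip x y ^+ 2 <= (`|x| * `|y|) ^+ 2.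
  rewrite exprMn -[X in X ^+ 2]cy exprMn [_ ^+ 2 ^+ 2]expr2 mulrA.
  rewrite ler_pM2r // (le_trans _ h) // -cy; lra.
by rewrite -ler_sqr ?nnegrE ?mulr_ge0 // real_normK ?num_real.
Qed.

Hypothesis iota_cont : continuous iota.

Let H_to_dual_fun (h : H) : V -> R^o := fun v => ip h (iota v).

Lemma H_to_dual_subproof h : H_to_dual_fun h \in dual_pred.
Proof.
have lf : linear (H_to_dual_fun h).
  by move=> a x y; rewrite /H_to_dual_fun linearP ip_linear.
rewrite inE; split=> // v; apply/(@cvgrPdist_le _ R^o) => e e0.
near=> w; rewrite /H_to_dual_fun.
have -> : ip h (iota v) - ip h (iota w) = ip h (iota (v - w)).
  by rewrite linearB [iota v - _]addrC -[- iota w]scaleN1r ip_linear mulN1r addrC.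
rewrite (le_trans (cauchy_schwarz _ _)) //.
rewrite (@le_trans _ _ ((`|h| + 1) * `|iota (v - w)|)) //.
  by rewrite ler_wpM2r // lerDl.
have h1 : 0 < `|h| + 1 by rewrite ltr_wpDl.
rewrite -ler_pdivlMl // linearB.
near: w; apply: cvgr_dist_le; first exact: iota_cont.
by rewrite mulr_gt0 // invr_gt0.
Unshelve. all: by end_near. Qed.

(* H is identified with its dual: h in H acts on V as v |-> <h, iota v>. *)
Definition H_to_dual (h : H) : dual V := Dual (H_to_dual_subproof h).

End Embedding.

(* A simple function is presented by a list of pairs (A, c) standing for the
   sum of the functions 1_A c, where every A is measurable of finite measure. *)

Section Bochner.
Context d {T : measurableType d} {R : realType} {E : normedModType R}.
Variable mu : {measure set T -> \bar R}.
Implicit Types (s : seq (set T * E)) (f : T -> E).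

Definition simple_ok s :=
  {in s, forall p, measurable p.1 /\ (mu p.1 < +oo)%E}.

Definition simple_val s (x : T) : E := \sum_(p <- s) \1_(p.1) x *: p.2.

Definition simple_int s : E := \sum_(p <- s) fine (mu p.1) *: p.2.

Definition strongly_measurable f := exists s : nat -> seq (set T * E),
  (forall n, simple_ok (s n)) /\
  {ae mu, forall x, simple_val (s n) x @[n --> \oo] --> f x}.

Definition is_bochner f (w : E) := exists s : nat -> seq (set T * E),
  [/\ forall n, simple_ok (s n),
      {ae mu, forall x, simple_val (s n) x @[n --> \oo] --> f x},
      (\int[mu]_x `|f x - simple_val (s n) x|%:E)%E @[n --> \oo] --> 0%E &
      simple_int (s n) @[n --> \oo] --> w].

Definition bochner_integrable f := exists w, is_bochner f w.

(* Equals 0 if [f] is not Bochner integrable. *)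
Definition bochner f : E := xget 0 [set w | is_bochner f w].

Definition LE_norm (p : R) f : \bar R := Lnorm mu p%:E (fun x => `|f x|%:E).

(* Elements of L^p are represented by functions; no quotient by a.e. equality
   is taken, and all notions below are invariant under a.e. modification. *)
Definition LE (p : R) : set (T -> E) :=
  [set f | strongly_measurable f /\ (LE_norm p f < +oo)%E].

End Bochner.

(* Functions on [0, oo[ are total functions on R of which only the restriction
   to [0, oo[ matters: they are taken modulo the following measure. *)
Definition half_line {R : realType} :
    {measure set (measurableTypeR R) -> \bar R} :=
  mrestr lebesgue_measure (measurable_itv `[(0 : R), +oo[).

Section Kernel.
Context {R : realType}.
Implicit Types (k : R -> R) (M : {measure set (measurableTypeR R) -> \bar R}).

(* The value [k 0] is irrelevant: [k] may blow up at 0. *)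
Record admissible_kernel k : Prop := {
  kernel_L1loc : forall T : R, 0 < T ->
    (@lebesgue_measure R).-integrable `[0, T] (EFin \o k) ;
  kernel_ge0 : forall s, 0 < s -> 0 <= k s ;
  kernel_nincr : forall s t, 0 < s -> s <= t -> k t <= k s ;
  kernel_rcont : forall s, 0 < s -> k x @[x --> s^'+] --> k s ;
  kernel_cvg0 : k x @[x --> +oo] --> 0 }.

Definition tail_measure k M :=
  M `]-oo, 0]%classic = 0%E /\
  forall s : R, 0 < s -> M `]s, +oo[%classic = (k s)%:E.

Definition laplace_exponent M (lambda : R) : R :=
  \int[M]_(tau in `]0, +oo[) (1 - expR (- lambda * tau)).

(* M^k is carried by ]0, oo[ and mu_t^k by [0, oo[; [tail_measure k M] and
   [convolution_semigroup M mu] determine them uniquely. *)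
Definition convolution_semigroup M
    (mu : R -> probability (measurableTypeR R) R) :=
  forall t, 0 <= t -> mu t `]-oo, 0[%classic = 0%E /\
    forall lambda, 0 < lambda ->
      \int[mu t]_(s in `[0, +oo[) expR (- lambda * s) =
      expR (- t * laplace_exponent M lambda).

End Kernel.

Section Operators.
Context {R : realType} {V H : completeNormedModType R}.
Variables (ip : inner_product H) (iota : {linear V -> H}).
Hypothesis iota_cont : continuous iota.
Variable alpha : R.
Variable mu : R -> probability (measurableTypeR R) R.
Implicit Types (u w : R -> H) (v : R -> V) (g : R -> dual V).

Definition time_shift (s : R) u (r : R) : H :=
  if 0 <= r - s then u (r - s) else 0.

Definition Ut (t : R) u (r : R) : H :=
  bochner (mu t) (fun s => time_shift s u r).

(* [Lambda_H u w] : u is in D(Lambda^k, calH) and Lambda^k u = w. *)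
Definition Lambda_H u w := [/\ LE half_line 2 u, LE half_line 2 w &
  LE_norm half_line 2 (fun r => t^-1 *: (Ut t u r - u r) - w r) @[t --> 0^'+]
    --> 0%E].

Definition dom_Lambda_H : set (R -> H) := [set u | exists w, Lambda_H u w].

(* calV is a space of V-valued functions; it sits in calH through
   v |-> iota \o v. *)
Definition calV : set (R -> V) :=
  [set v | LE half_line alpha v /\ LE half_line 2 (iota \o v)].

Definition calV_norm v : \bar R :=
  maxe (LE_norm half_line alpha v) (LE_norm half_line 2 (iota \o v)).

Local Notation j := (H_to_dual ip iota_cont).

Definition calVs_decomposition g (g1 : R -> dual V) (g2 : R -> H) :=
  [/\ LE half_line (alpha / (alpha - 1)) g1, LE half_line 2 g2 &
      {ae half_line, forall t, g t = g1 t + j (g2 t)}].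

Definition calVs : set (R -> dual V) :=
  [set g | exists g1 (g2 : R -> H), calVs_decomposition g g1 g2].

Definition calVs_norm g : \bar R := ereal_inf [set x | exists g1 (g2 : R -> H),
  calVs_decomposition g g1 g2 /\
  x = (LE_norm half_line (alpha / (alpha - 1)) g1 +
       LE_norm half_line 2 g2)%E].

(* Graph of the closure, from calV to calV^*, of Lambda^k restricted to
   D(Lambda^k, calH) /\ calV. *)
Definition Lambda_F v g := [/\ calV v, calVs g &
  exists (v_ : nat -> R -> V) (w_ : nat -> R -> H),
    [/\ forall n, calV (v_ n) /\ Lambda_H (iota \o v_ n) (w_ n),
        calV_norm (v_ n \- v) @[n --> \oo] --> 0%E &
        calVs_norm ((j \o w_ n) \- g) @[n --> \oo] --> 0%E]].

Definition F_space : set (R -> V) := [set v | exists g, Lambda_F v g].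

End Operators.

Section WeakDerivative.
Context {R : realType} {H : completeNormedModType R}.
Implicit Types (f g u : R -> H).

Definition causal_conv (k : R -> R) u (t : R) : H :=
  bochner half_line (fun s => (\1_`[0, t] s * k (t - s)) *: u s).

Definition test_function (phi : R -> R) :=
  (forall n x, derivable (derive1n n phi) x 1) /\
  exists B : R, forall x, B < `|x| -> phi x = 0.

Definition locally_bochner_integrable f := forall T : R, 0 < T ->
  bochner_integrable half_line (fun t => \1_`[0, T] t *: f t).

(* Both functions are extended by 0 to the negative half-line, so the test
   functions live on R and need not vanish at 0. *)
Definition weak_derivative f g :=
  [/\ locally_bochner_integrable f, locally_bochner_integrable g &
      forall phi, test_function phi ->
        bochner half_line (fun t => derive1 phi t *: f t) =
        - bochner half_line (fun t => phi t *: g t)].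

End WeakDerivative.

(* Main.v *)
Require Import Defs.
From HB Require Import structures.
From mathcomp Require Import all_boot all_order all_algebra.
From mathcomp Require Import all_classical all_reals all_analysis measurable_realfun.
From mathcomp Require Import ring lra.

Set Implicit Arguments.
Unset Strict Implicit.
Unset Printing Implicit Defensive.
Import Order.TTheory GRing.Theory Num.Theory.
Import numFieldNormedType.Exports.
Local Open Scope classical_set_scope.
Local Open Scope ring_scope.

(** For the second claim, pair everything with a vector h of H and write a, b and
    f for the real functions <h, u>, <h, w> and <h, k * u> on the half-line. The
    identity to be shown is int phi' f = int phi b for every test function phi,
    and it is obtained from Laplace transforms.

    On one side, U_t is the convolution with mu_t, whose transform at l is
    exp (- t psi l). Hence (U_t a - a) / t has transform
    (exp (- t psi l) - 1) / t times that of a. The difference quotient converges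
    to w in L^2, and exp (- l x) is square integrable, so as t tends to 0 the
    transform of b is - psi l times that of a (generator_laplace). On the other
    side, k * u has as transform the product of those of k and a
    (causal_conv_repr), and l times the transform of k is psi l, because k is the
    tail of M (laplace_exponent_kernel). So l times the transform of f is minus
    the transform of b: the identity holds for phi = exp (- l x).

    Sums of the exponentials exp (- l x) with l = 1, 2, .. approximate a test
    function together with its derivative, up to eps exp (- x) on the half-line:
    this is Weierstrass' theorem in the variable exp (- x) (exp_sum_approx). Since
    exp (- x) is integrable against f and b, the identity passes to the limit
    (laplace_weak_derivative).

    Passing from vectors to scalars rests on Pettis' theorem: as H is separable,
    a function with integrable norm is Bochner integrable as soon as its pairings
    with vectors are measurable, and its integral is determined by the integrals
    of these pairings (bochner_spec). In particular Fubini's theorem carries over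
    to Bochner integrals (bochner_fubini), which gives measurable representatives
    of U_t u and k * u.

    The first claim needs no approximation: a function of the domain that lies in
    calV already belongs to the graph whose closure is taken. *)

(** * Nonnegative integrals up to null sets *)

Section NonnegativeIntegrals.
Context d (T : measurableType d) (R : realType).
Variable mu : {measure set T -> \bar R}.
Local Open Scope ereal_scope.
Import HBNNSimple.

(** The integral of a nonnegative function is a supremum over simple functions
    below it, and a simple function may be cut off to 0 on a null set; this holds
    for arbitrary functions. It is applied to elements of L^p, which are
    represented by functions that are measurable only up to a null set. *)
Lemma ge0_ae_le_integralT (f g : T -> \bar R) :
  (forall x, 0 <= f x) -> (forall x, 0 <= g x) ->
  {ae mu, forall x, f x <= g x} -> \int[mu]_x f x <= \int[mu]_x g x.
Proof.
move=> f0 g0 [N [mN N0 subN]].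
rewrite ge0_integralE// patch_setT; apply: ge_ereal_sup => _ [h /= hf <-].
pose h' := mul_nnsfun h (indic_nnsfun R (measurableC mN)).
rewrite -integralT_nnsfun (_ : \int[mu]_x _ = \int[mu]_x (h' x)%:E).
  rewrite integralT_nnsfun (ge0_integralE _ (fun x _ => g0 x)) patch_setT.
  apply: ereal_sup_ubound; exists h' => //= x.
  rewrite [indic_nnsfun _ _ x]indicE; case: (boolP (x \in ~` N)) => /=; last first.
    by rewrite mulr0.
  rewrite inE mulr1 => xN; apply: (le_trans (hf x)).
  by apply: contra_notT xN => /negP xN; exact: subN.
apply: ge0_ae_eq_integral => //.
- exact/measurable_EFinP.
- exact/measurable_EFinP.
- by move=> x _; rewrite lee_fin.
- by move=> x _; rewrite lee_fin.
- exists N; split => // x /=; apply: contra_notP => xN _.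
  by rewrite [indic_nnsfun _ _ x]indicE mem_set ?mulr1.
Qed.

Lemma ge0_ae_eq_integralT (f g : T -> \bar R) :
  (forall x, 0 <= f x) -> (forall x, 0 <= g x) ->
  {ae mu, forall x, f x = g x} -> \int[mu]_x f x = \int[mu]_x g x.
Proof.
move=> f0 g0 fg; apply/eqP; rewrite eq_le; apply/andP; split.
  by apply: ge0_ae_le_integralT => //; apply: filterS fg => x ->.
by apply: ge0_ae_le_integralT => //; apply: filterS fg => x ->.
Qed.

End NonnegativeIntegrals.

(** * Weak measurability in a Hilbert space *)

Section InnerProduct.
Context {R : realType} {H : completeNormedModType R}.
Variable ip : inner_product H.

Lemma ipD h x y : ip h (x + y) = ip h x + ip h y.
Proof. by rewrite -[x in LHS]scale1r ip_linear mul1r. Qed.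

Lemma ipN h x : ip h (- x) = - ip h x.
Proof. by rewrite -scaleN1r ipZ mulN1r. Qed.

Lemma ipB h x y : ip h (x - y) = ip h x - ip h y.
Proof. by rewrite ipD ipN. Qed.

Lemma ip_sum h I (s : seq I) (F : I -> H) :
  ip h (\sum_(i <- s) F i) = \sum_(i <- s) ip h (F i).
Proof.
by elim/big_ind2 : _ => [|x1 x2 y1 y2 <- <-|//]; rewrite ?ip0// ipD.
Qed.

Lemma ip_eqP x y : (forall h, ip h x = ip h y) -> x = y.
Proof.
move=> xy; apply/subr0_eq/normr0_eq0/eqP.
by rewrite -sqrf_eq0 -(ip_norm ip) ipB xy subrr.
Qed.

Lemma ip_cvg h T (F : set_system T) (FF : Filter F) (x_ : T -> H) x :
  x_ @ F --> x -> ip h (x_ t) @[t --> F] --> ip h x.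
Proof.
move=> /cvgrPdist_le xx; apply/cvgrPdist_le => e e0.
have h1 : 0 < `|h| + 1 by rewrite ltr_wpDl.
have := xx (e / (`|h| + 1)); rewrite divr_gt0// => /(_ isT).
apply: filterS => t xt; rewrite -ipB (le_trans (cauchy_schwarz _ _ _))//.
rewrite (@le_trans _ _ ((`|h| + 1) * `|x - x_ t|))//.
  by rewrite ler_wpM2r// lerDl.
by rewrite mulrC -ler_pdivlMr.
Qed.

(** Completing the square: the left-hand side is affine in y, and its supremum
    over x in a dense set is the squared norm of y. *)
Lemma ip_norm_gap x y : 2 * ip x y - `|x| ^+ 2 = `|y| ^+ 2 - `|y - x| ^+ 2.
Proof.
rewrite -!(ip_norm ip) ipB [ip (y - x) y](ipC ip) [ip (y - x) x](ipC ip) !ipB.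
by rewrite (ipC ip y x); ring.
Qed.

Lemma dense_sequence : separable_space H ->
  exists2 e : nat -> H, e 0%N = 0 &
    forall x eps, 0 < eps -> exists n, `|x - e n| < eps.
Proof.
move=> [A /countable_injP[f finj] dA].
pose e n := if n is n'.+1 then xget 0 [set a | A a /\ f a = n'] else 0.
exists e => // x eps eps0.
have [a [xa Aa]] := dA (ball x eps) (ex_intro _ x (ballxx x eps0))
  (ball_open x eps).
exists (f a).+1; rewrite /= (_ : xget _ _ = a)//.
  by move: xa; rewrite -ball_normE.
case: xgetP => [b _ [Ab fab]|/(_ a)]; last by move=> /= []; split.
by apply: finj => //; rewrite inE.
Qed.

Definition weakly_measurable d (T : measurableType d) (g : T -> H) :=
  forall h, measurable_fun setT (fun x => ip h (g x)).

Section WeaklyMeasurable.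
Context d {T : measurableType d}.
Implicit Types g : T -> H.

Lemma weakly_measurable_cst c : weakly_measurable (fun _ : T => c).
Proof. by move=> h; exact: measurable_cst. Qed.

Lemma weakly_measurableD g1 g2 : weakly_measurable g1 ->
  weakly_measurable g2 -> weakly_measurable (fun x => g1 x + g2 x).
Proof.
move=> m1 m2 h; under eq_fun do rewrite ipD.
by apply: measurable_funD; [exact: m1|exact: m2].
Qed.

Lemma weakly_measurableZ (a : T -> R) g : measurable_fun setT a ->
  weakly_measurable g -> weakly_measurable (fun x => a x *: g x).
Proof.
move=> ma mg h; under eq_fun do rewrite ipZ.
by apply: measurable_funM => //; exact: mg.
Qed.

Lemma weakly_measurableB g1 g2 : weakly_measurable g1 ->
  weakly_measurable g2 -> weakly_measurable (fun x => g1 x - g2 x).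
Proof.
move=> m1 m2 h; under eq_fun do rewrite ipB.
by apply: measurable_funB; [exact: m1|exact: m2].
Qed.

Lemma weakly_measurable_comp d' (T' : measurableType d') (f : T' -> T) g :
  measurable_fun setT f -> weakly_measurable g ->
  weakly_measurable (fun x => g (f x)).
Proof. by move=> mf mg h; apply: (measurableT_comp (mg h)). Qed.

Lemma weakly_measurable_simple_val (s : seq (set T * H)) :
  {in s, forall p, measurable p.1} -> weakly_measurable (simple_val s).
Proof.
move=> ms h; rewrite /simple_val; under eq_fun do rewrite ip_sum.
elim: s ms => [|p s ih] ms.
  by under eq_fun do rewrite big_nil; exact: measurable_cst.
under eq_fun do rewrite big_cons ipZ.
apply: measurable_funD; last first.
  by apply: ih => q qs; apply: ms; rewrite inE qs orbT.
by apply: measurable_funM => //; apply/measurable_indic/ms; rewrite mem_head.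
Qed.

Hypothesis H_separable : separable_space H.

(** The squared norm is the supremum over a dense sequence of points e of the
    affine functionals 2 <e, y> - |e|^2, so weak measurability is enough. This
    half of Pettis' theorem is where separability enters. *)
Lemma measurable_normr g :
  weakly_measurable g -> measurable_fun setT (fun x => `|g x|).
Proof.
move=> mg; have [e _ de] := dense_sequence H_separable.
pose a n x := 2 * ip (e n) (g x) - `|e n| ^+ 2.
have a_ub x : ubound (range (a ^~ x)) (`|g x| ^+ 2).
  by move=> _ [n _ <-]; rewrite /a ip_norm_gap gerBl sqr_ge0.
have -> : (fun x => `|g x|) = Num.sqrt \o (fun x => sups (a ^~ x) 0%N).
  apply/funext => x /=; rewrite -[LHS]normr_id -sqrtr_sqr; congr (Num.sqrt _).
  rewrite /sups /=.
  have -> : sdrop (a ^~ x) 0%N = range (a ^~ x).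
    by apply/seteqP; split=> _ [n /= _ <-]; exists n.
  apply/eqP; rewrite eq_le; apply/andP; split; last first.
    by apply: ge_sup => //; exists (a 0%N x), 0%N.
  apply/ler_addgt0Pr => eps eps0.
  have [n gn] := de (g x) (Num.sqrt eps) ltac:(by rewrite sqrtr_gt0).
  apply: (@le_trans _ _ (a n x + eps)); last first.
    rewrite lerD2r; apply: ub_le_sup; last by exists n.
    by exists (`|g x| ^+ 2); exact: a_ub.
  rewrite /a ip_norm_gap.
  have : `|g x - e n| ^+ 2 <= eps; last lra.
  by rewrite -[leRHS](sqr_sqrtr (ltW eps0)) ler_sqr ?nnegrE ?sqrtr_ge0// ltW.
apply: measurableT_comp.
  by apply: continuous_measurable_fun; exact: sqrt_continuous.
apply: measurable_fun_sups.
  by move=> x _; exists (`|g x| ^+ 2); exact: a_ub.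
move=> n; apply: measurable_funB => //; exact: measurable_funM.
Qed.

End WeaklyMeasurable.

End InnerProduct.

(** * Weak integrals and simple functions *)

Section WeakIntegral.
Context {R : realType} {H : completeNormedModType R}.
Variable ip : inner_product H.
Hypothesis H_separable : separable_space H.
Context d {T : measurableType d}.
Variable mu : {measure set T -> \bar R}.
Implicit Types (f g : T -> H) (s : seq (set T * H)).

(** Only the values on a measurable null set have to be changed: off it, the
    function is an everywhere limit of simple functions. *)
Lemma strongly_measurable_repr f : strongly_measurable mu f ->
  exists2 g, weakly_measurable ip g & {ae mu, forall x, f x = g x}.
Proof.
move=> [s [sok [N [mN N0 subN]]]].
exists (fun x => (\1_(~` N) x : R) *: f x) => [h|]; last first.
  exists N; split => // x /=; apply: contra_notP => xN.
  by rewrite indicE mem_set// scale1r.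
apply: (@measurable_fun_cvg _ _ _ _
  (fun n x => \1_(~` N) x * ip h (simple_val (s n) x))).
  move=> n; apply: measurable_funM.
    exact/measurable_indic/measurableC.
  by apply: weakly_measurable_simple_val => p /(sok n)[].
move=> x _; rewrite ipZ indicE; have [xN|_] := boolP (x \in ~` N); last first.
  by rewrite mul0r; under eq_fun do rewrite mul0r; exact: cvg_cst.
apply: cvgMl_tmp; apply: ip_cvg.
by move/set_mem: xN; apply: contra_notP => xN; exact: subN.
Qed.

Lemma integrable_ip g h : weakly_measurable ip g ->
  (\int[mu]_x `|g x|%:E < +oo)%E ->
  mu.-integrable setT (fun x => (ip h (g x))%:E).
Proof.
move=> mg gfin; apply: (@le_integrable _ _ _ _ _ _ _
  (fun x => `|h|%:E * `|g x|%:E)%E) => //.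
- by apply/measurable_EFinP; exact: mg.
- move=> x _; rewrite -EFinM !abse_EFin lee_fin normrM !normr_id.
  exact: cauchy_schwarz.
- apply: integrableZl => //; apply/integrableP; split.
    by apply/measurable_EFinP; exact: (measurable_normr H_separable mg).
  by under eq_integral do rewrite abse_EFin normr_id.
Qed.

Lemma weak_integral_le g h : weakly_measurable ip g ->
  (\int[mu]_x `|g x|%:E < +oo)%E ->
  (`|\int[mu]_x (ip h (g x))%:E| <= `|h|%:E * \int[mu]_x `|g x|%:E)%E.
Proof.
move=> mg gfin; have mn := measurable_normr H_separable mg.
have mE : measurable_fun setT (fun x => `|g x|%:E) by apply/measurable_EFinP.
rewrite -ge0_integralZl//.
apply: (le_trans (le_abse_integral _ _ _)) => //.
  by apply/measurable_EFinP; exact: mg.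
apply: ge0_le_integral => //.
- by apply: measurableT_comp => //; apply/measurable_EFinP; exact: mg.
- exact: measurable_funeM.
- by move=> x _; rewrite -EFinM abse_EFin lee_fin cauchy_schwarz.
Qed.

(** Pairing w with itself turns a bound on the functionals <h, w> into a bound
    on the norm. *)
Lemma weak_integral_norm_le g w : weakly_measurable ip g ->
  (forall h, (ip h w)%:E = \int[mu]_x (ip h (g x))%:E)%E ->
  (`|w|%:E <= \int[mu]_x `|g x|%:E)%E.
Proof.
move=> mg wg; have [gfin|] := ltP (\int[mu]_x `|g x|%:E)%E +oo%E; last first.
  by apply: le_trans; exact: leey.
have [->|w0] := eqVneq w 0.
  by rewrite normr0 integral_ge0// => x _; rewrite lee_fin.
have := weak_integral_le w mg gfin.
rewrite -wg ip_norm abse_EFin ger0_norm ?sqr_ge0// expr2 EFinM.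
by rewrite lee_pmul2l// ?lte_fin ?normr_gt0// fin_numE.
Qed.

Lemma simple_ok_cons p s : simple_ok mu (p :: s) ->
  [/\ measurable p.1, (mu p.1 < +oo)%E & simple_ok mu s].
Proof.
move=> sok; have [mp pfin] := sok p (mem_head _ _); split => // q qs.
by apply: sok; rewrite inE qs orbT.
Qed.

Lemma simple_val_cons p s :
  simple_val (p :: s) = (fun x => (\1_(p.1) x : R) *: p.2 + simple_val s x).
Proof. by apply/funext => x; rewrite /simple_val big_cons. Qed.

Lemma simple_val_fin s : simple_ok mu s ->
  (\int[mu]_x `|simple_val s x|%:E < +oo)%E.
Proof.
elim: s => [_|p s ih /simple_ok_cons[mp pfin sok]].
  by rewrite integral0_eq// => x _; rewrite /simple_val big_nil normr0.
have ms : weakly_measurable ip (simple_val s).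
  by apply: weakly_measurable_simple_val => q /sok[].
have mns := measurable_normr H_separable ms.
have mi : measurable_fun setT (\1_(p.1) : T -> R) by exact/measurable_indic.
apply: (@le_lt_trans _ _ (\int[mu]_x (`|p.2|%:E * (\1_(p.1) x)%:E +
   `|simple_val s x|%:E))%E).
  apply: ge0_le_integral => //.
  - apply/measurable_EFinP/(measurable_normr H_separable (ip := ip)).
    rewrite simple_val_cons; apply: weakly_measurableD => //.
    by apply: weakly_measurableZ => //; exact: weakly_measurable_cst.
  - apply: emeasurable_funD; last exact/measurable_EFinP.
    by apply: measurable_funeM; exact/measurable_EFinP.
  - move=> x _; rewrite simple_val_cons -EFinM -EFinD lee_fin.
    rewrite (le_trans (ler_normD _ _))// lerD2r normrZ mulrC.
    by rewrite ler_wpM2l// ger0_norm// indicE.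
have mE1 : measurable_fun setT (fun x => (\1_(p.1) x : R)%:E).
  exact/measurable_EFinP.
have mE2 : measurable_fun setT (fun x => `|simple_val s x|%:E).
  exact/measurable_EFinP.
have i0 x : (0 <= (\1_(p.1) x : R)%:E)%E by rewrite lee_fin indicE.
rewrite ge0_integralD//; last exact: measurable_funeM.
rewrite lte_add_pinfty ?ih// ge0_integralZl//.
rewrite integral_indic// setIT lte_mul_pinfty// fin_numE//.
Qed.

Lemma simple_int_ip s h : simple_ok mu s ->
  (\int[mu]_x (ip h (simple_val s x))%:E = (ip h (simple_int mu s))%:E)%E.
Proof.
elim: s => [_|p s ih /simple_ok_cons[mp pfin sok]].
  rewrite /simple_int big_nil ip0 integral0_eq// => x _.
  by rewrite /simple_val big_nil ip0.
have ms : weakly_measurable ip (simple_val s).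
  by apply: weakly_measurable_simple_val => q /sok[].
have int_indic : mu.-integrable setT (fun x => (\1_(p.1) x : R)%:E).
  apply/integrableP; split; first exact/measurable_EFinP/measurable_indic.
  under eq_integral do rewrite abse_EFin ger0_norm ?indicE//.
  by rewrite integral_indic// setIT.
rewrite simple_val_cons.
under eq_integral do rewrite ipD ipZ EFinD EFinM muleC.
have int_s : mu.-integrable setT (fun x => (ip h (simple_val s x))%:E).
  by apply: integrable_ip => //; exact: simple_val_fin.
rewrite integralD//; last exact: integrableZl.
rewrite integralZl// integral_indic// setIT ih// /simple_int big_cons.
by rewrite ipD ipZ EFinD EFinM fineK ?ge0_fin_numE// muleC.
Qed.

End WeakIntegral.

(** * Approximation by simple functions *)

Section BochnerIntegral.
Context {R : realType} {H : completeNormedModType R}.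
Variable ip : inner_product H.
Hypothesis H_separable : separable_space H.
Context d {T : measurableType d}.
Variable mu : {measure set T -> \bar R}.
Implicit Types (f g : T -> H) (s : seq (set T * H)).

(** The n-th simple function maps x to the point nearest to g x among the first
    n + 1 points of a dense sequence. As that sequence starts at 0, the error
    is at most |g|, which allows dominated convergence; and cutting off to 0
    where |g| is below 1 / (n + 1) makes the level sets of finite measure. *)
Lemma norm_approx g : weakly_measurable ip g ->
  (\int[mu]_x `|g x|%:E < +oo)%E -> exists q : nat -> seq (set T * H),
  [/\ forall n, simple_ok mu (q n),
      forall n x, `|g x - simple_val (q n) x| <= `|g x| &
      forall x, simple_val (q n) x @[n --> \oo] --> g x].
Proof.
move=> mg gfin; have [e e0 de] := dense_sequence H_separable.
have me c : measurable_fun setT (fun x => `|g x - c|).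
  apply: (measurable_normr H_separable (ip := ip)).
  by apply: weakly_measurableB => //; exact: weakly_measurable_cst.
have mall (r : seq nat) (b : nat -> T -> bool) :
    (forall j, measurable_fun setT (b j)) ->
    measurable_fun setT (fun x => all (b ^~ x) r).
  move=> mb; elim: r => [|j r ih] /=; first exact: measurable_cst.
  exact: measurable_and.
pose large n x := (n.+1%:R^-1 <= `|g x|).
(* Ties are broken by the smallest index, which makes the sets A n i disjoint. *)
pose near n i x := all (fun j => `|g x - e i| <= `|g x - e j|) (iota 0 n.+1).
pose first n i x := near n i x && all (fun j => ~~ near n j x) (iota 0 i).
pose A n i := [set x | first n i x && large n x].
pose q n : seq (set T * H) := [seq (A n i, e i) | i <- iota 0 n.+1].
have mnear n i : measurable_fun setT (near n i).
  by apply: mall => j; exact: measurable_fun_ler.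
have mlarge n : measurable_fun setT (large n).
  apply: measurable_fun_ler => //.
  by have := me 0; under eq_fun do rewrite subr0.
have mA n i : measurable (A n i).
  have : measurable_fun setT (fun x => first n i x && large n x).
    apply: measurable_and => //; apply: measurable_and => //.
    by apply: mall => j; apply: measurable_neg.
  by move=> /(_ measurableT [set true] I); rewrite setTI.
have qE n x : large n x -> exists2 i, (i <= n)%N &
    near n i x /\ simple_val (q n) x = e i.
  move=> lnx.
  have exnear : exists i, (i < n.+1)%N && near n i x.
    have [i _ imin] := arg_minP (fun i : 'I_n.+1 => `|g x - e i|)
      (isT : xpredT ord0).
    exists i; rewrite ltn_ord; apply/allP => j; rewrite mem_iota add0n => /= jn.
    exact: (imin (Ordinal jn)).
  case: (ex_minnP exnear) => i /andP[iln ni] imin; exists i => //; split => //.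
  have Ai : A n i x.
    rewrite /A /= lnx andbT /first ni /=; apply/allP => j.
    rewrite mem_iota add0n => /= ji; apply/negP => nj.
    by have := imin j; rewrite nj (ltn_trans ji iln) leqNgt ji => /(_ isT).
  have mr j : (j \in iota 0 n.+1) = (j < n.+1)%N by rewrite mem_iota.
  rewrite /simple_val big_map; move: (iota_uniq 0 n.+1) mr.
  move: (iota 0 n.+1) => r ur mr.
  rewrite (bigD1_seq i) ?mr//= big1_seq.
    by rewrite indicE mem_set// scale1r addr0.
  move=> j /andP[ji]; rewrite mr => jn.
  rewrite indicE memNset ?scale0r//= => /andP[/andP[nj /allP jfirst] _].
  have [ij|ij|ij] := ltngtP i j.
  - by have := jfirst i; rewrite mem_iota add0n ni => /(_ ij).
  - by have := imin j; rewrite nj jn leqNgt ij => /(_ isT).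
  - by rewrite ij eqxx in ji.
have qN n x : ~~ large n x -> simple_val (q n) x = 0.
  move=> lnx; rewrite /simple_val big_map big1// => i _.
  by rewrite indicE memNset ?scale0r//= => /andP[_]; rewrite (negbTE lnx).
exists q; split.
- move=> n p /mapP[i _ ->] /=; split => //.
  have n0 : 0 < n.+1%:R^-1 :> R by rewrite invr_gt0.
  have mnE : measurable_fun setT (fun x => `|g x|%:E).
    apply/measurable_EFinP; exact: (measurable_normr H_separable mg).
  have := le_integral_abse mu measurableT mnE n0.
  rewrite setTI; under eq_integral do rewrite abse_EFin normr_id.
  move=> /le_lt_trans/(_ gfin).
  rewrite lte_pdivrMl// gt0_muley// => /(le_lt_trans _); apply.
  apply: le_measure; rewrite ?inE//.
    have : measurable_fun setT (large n) by exact: mlarge.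
    move=> /(_ measurableT [set true] I); rewrite setTI.
    congr measurable; apply/seteqP; split=> x /=;
      by rewrite /large lee_fin normr_id.
  by move=> x /andP[_]; rewrite /large /= lee_fin normr_id.
- move=> n x; have [lnx|/qN->] := boolP (large n x); last by rewrite subr0.
  have [i _ [/allP/(_ 0%N) + ->]] := qE n x lnx.
  by rewrite e0 subr0; apply; rewrite mem_iota.
- move=> x; have [gx0|gx0] := eqVneq (g x) 0.
    have -> : (fun n => simple_val (q n) x) = fun=> g x.
      apply/funext => n; rewrite gx0 qN// /large gx0 normr0 -ltNge.
      by rewrite invr_gt0.
    exact: cvg_cst.
  apply/cvgrPdist_lt => eps eps0; have [j gj] := de (g x) eps eps0.
  have gx_gt0 : 0 < `|g x| by rewrite normr_gt0.
  near=> n; have lnx : large n x.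
    by apply: ltW; near: n; exact: (near_infty_natSinv_lt (PosNum gx_gt0)).
  have [i _ [/allP/(_ j) + ->]] := qE n x lnx.
  move=> /[1!mem_iota] /= /(_ _)/le_lt_trans; apply => //.
  by near: n; exact: nbhs_infty_ge.
Unshelve. all: by end_near. Qed.

End BochnerIntegral.

(** * The Bochner integral through its pairings *)

Section BochnerPettis.
Context {R : realType} {H : completeNormedModType R}.
Variable ip : inner_product H.
Hypothesis H_separable : separable_space H.
Context d {T : measurableType d}.
Variable mu : {measure set T -> \bar R}.
Implicit Types (f g : T -> H) (s : seq (set T * H)).

Lemma measurable_normrE g : weakly_measurable ip g ->
  measurable_fun setT (fun x => `|g x|%:E).
Proof. by move=> mg; apply/measurable_EFinP/(measurable_normr H_separable mg). Qed.

Lemma weakly_measurable_simple_ok s : simple_ok mu s ->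
  weakly_measurable ip (simple_val s).
Proof. by move=> sok; apply: weakly_measurable_simple_val => p /sok[]. Qed.

Lemma integral_normD g1 g2 : weakly_measurable ip g1 ->
  weakly_measurable ip g2 ->
  (\int[mu]_x `|g1 x + g2 x|%:E <=
   \int[mu]_x `|g1 x|%:E + \int[mu]_x `|g2 x|%:E)%E.
Proof.
move=> m1 m2; have mE1 := measurable_normrE m1; have mE2 := measurable_normrE m2.
rewrite -ge0_integralD//; apply: ge0_le_integral => //.
- exact/measurable_normrE/weakly_measurableD.
- exact: emeasurable_funD.
- by move=> x _; rewrite -EFinD lee_fin ler_normD.
Qed.

(** This makes the integrals of an approximating sequence a Cauchy sequence. *)
Lemma simple_int_dist s1 s2 : simple_ok mu s1 -> simple_ok mu s2 ->
  (`|simple_int mu s1 - simple_int mu s2|%:E <=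
   \int[mu]_x `|simple_val s1 x - simple_val s2 x|%:E)%E.
Proof.
move=> ok1 ok2; have m1 := weakly_measurable_simple_ok ok1.
have m2 := weakly_measurable_simple_ok ok2.
apply: (weak_integral_norm_le H_separable (weakly_measurableB m1 m2)) => h.
under eq_integral do rewrite ipB EFinB.
by rewrite integralB ?simple_int_ip// ?ipB ?EFinB//;
  apply: (integrable_ip H_separable) => //; exact: (simple_val_fin ip).
Qed.

(** Pettis: over a separable space, a weakly measurable function with integrable
    norm is Bochner integrable. *)
Lemma is_bochner_exists g : weakly_measurable ip g ->
  (\int[mu]_x `|g x|%:E < +oo)%E -> exists w, is_bochner mu g w.
Proof.
move=> mg gfin; have [q [qok qle qcvg]] := norm_approx H_separable mg gfin.
have mq n := weakly_measurable_simple_ok (qok n).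
have mE := measurable_normrE mg.
have mgq n : weakly_measurable ip (fun x => g x - simple_val (q n) x).
  exact: weakly_measurableB.
have int0 : (\int[mu]_x `|g x - simple_val (q n) x|%:E)%E @[n --> \oo] --> 0%E.
  rewrite -(integral0 mu setT).
  apply: (@dominated_cvg _ _ _ mu setT measurableT _ _ (fun x => `|g x|%:E)).
  - by move=> n; exact: measurable_normrE.
  - move=> x _; apply: cvg_EFin; first exact: nearW.
    rewrite -(normr0 H); apply: cvg_norm; rewrite -(subrr (g x)).
    by apply: cvgB => //; exact: cvg_cst.
  - by [].
  - by apply/integrableP; split => //; under eq_integral do rewrite abse_EFin normr_id.
  - by move=> n x _; rewrite abse_EFin lee_fin normr_id.
have near0 eps : 0 < eps ->
    \forall n \near \oo, (\int[mu]_x `|g x - simple_val (q n) x|%:E < eps%:E)%E.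
  move=> eps0; move/fine_cvgP: int0 => [fin0 /cvgrPdist_lt/(_ _ eps0)].
  apply: filterS2 fin0 => n fn; rewrite sub0r normrN.
  by move/(le_lt_trans (ler_norm _)); rewrite -lte_fin fineK.
have /cauchy_cvgP/cvg_ex[w qw] : cauchy (simple_int mu (q n) @[n --> \oo]).
  apply: cauchy_exP => eps eps0.
  have e2 : 0 < eps / 2 by rewrite divr_gt0.
  have [N _ NP] := near0 _ e2.
  exists (simple_int mu (q N)); exists N => // n /= Nn.
  rewrite -ball_normE /= -lte_fin.
  apply: (le_lt_trans (simple_int_dist (qok N) (qok n))).
  apply: (@le_lt_trans _ _ (\int[mu]_x
      `|- (g x - simple_val (q N) x) + (g x - simple_val (q n) x)|%:E)%E).
    rewrite le_eqVlt; apply/orP; left; apply/eqP; apply: eq_integral => x _.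
    by rewrite opprB addrA subrK.
  have mN : weakly_measurable ip (fun x => - (g x - simple_val (q N) x)).
    by move=> h; under eq_fun do rewrite ipN; apply: measurableT_comp => //; exact: mgq.
  apply: (le_lt_trans (integral_normD mN (mgq n))).
  under eq_integral do rewrite normrN.
  by rewrite [eps]splitr EFinD; apply: lteD; apply: NP => /=.
exists w, q; split => //; exact: aeW.
Qed.

(** Continuous functionals commute with the limit defining the integral. Since
    the functionals <h, .> separate points, this characterizes the integral, and
    from here on identities between vector integrals are checked on scalars. *)
Lemma is_bochner_ip f g w : is_bochner mu f w -> weakly_measurable ip g ->
  {ae mu, forall x, f x = g x} ->
  (\int[mu]_x `|g x|%:E < +oo)%E /\
  forall h, (ip h w)%:E = (\int[mu]_x (ip h (g x))%:E)%E.
Proof.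
move=> [q [qok _ int0 intw]] mg fg.
have {}int0 : (\int[mu]_x `|g x - simple_val (q n) x|%:E)%E @[n --> \oo] --> 0%E.
  apply: cvg_trans int0; apply: near_eq_cvg; apply: nearW => n.
  apply: ge0_ae_eq_integralT => [x|x|]; rewrite ?lee_fin//.
  by apply: filterS fg => x ->.
have mq n := weakly_measurable_simple_ok (qok n).
have mgq n : weakly_measurable ip (fun x => g x - simple_val (q n) x).
  exact: weakly_measurableB.
have [fin0 int0'] := (fine_cvgP _ _).1 int0.
have gfin : (\int[mu]_x `|g x|%:E < +oo)%E.
  have [N _ /(_ N (leqnn _)) finN] := fin0.
  apply: (@le_lt_trans _ _ (\int[mu]_x
      `|(g x - simple_val (q N) x) + simple_val (q N) x|%:E)%E).
    by under [leRHS]eq_integral do rewrite subrK.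
  apply: (le_lt_trans (integral_normD (mgq N) (mq N))).
  by rewrite lte_add_pinfty// ?(simple_val_fin ip H_separable (qok N))// ltey_eq finN.
split => // h.
have gint := integrable_ip H_separable h mg gfin.
have gfinn : (\int[mu]_x (ip h (g x))%:E)%E \is a fin_num.
  exact: integrable_fin_num.
rewrite -(fineK gfinn); congr EFin.
have ipw : ip h (simple_int mu (q n)) @[n --> \oo] --> ip h w by exact: ip_cvg.
rewrite -(cvg_lim _ ipw)//; apply/cvg_lim => //.
apply/cvgrPdist_le => eps eps0.
have h1 : 0 < `|h| + 1 by rewrite ltr_wpDl.
have e1 : 0 < eps / (`|h| + 1) by rewrite divr_gt0.
move/cvgrPdist_le : int0' => /(_ _ e1); apply: filterS2 fin0 => n finn.
rewrite sub0r normrN => dn.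
have qint := integrable_ip H_separable h (mq n) (simple_val_fin ip H_separable (qok n)).
rewrite -lee_fin -abse_EFin EFinB fineK// -(simple_int_ip _ H_separable)//.
rewrite -integralB//.
under eq_integral do rewrite -EFinB -ipB.
apply: (le_trans (weak_integral_le H_separable h (mgq n) _)).
  by rewrite ltey_eq finn.
rewrite -(fineK finn) -EFinM lee_fin.
rewrite (@le_trans _ _ ((`|h| + 1) * (eps / (`|h| + 1))))//.
  by rewrite ler_pM// ?lerDl// ?fine_ge0 ?integral_ge0// (le_trans (ler_norm _)).
by rewrite mulrC divfK// gt_eqF.
Qed.

Lemma is_bochner_ae f g w : {ae mu, forall x, f x = g x} ->
  is_bochner mu g w -> is_bochner mu f w.
Proof.
move=> fg [q [qok qg int0 intw]]; exists q; split => //.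
  by apply: filterS2 fg qg => x ->.
apply: cvg_trans int0; apply: near_eq_cvg; apply: nearW => n.
apply: ge0_ae_eq_integralT => [x|x|]; rewrite ?lee_fin//.
by apply: filterS fg => x ->.
Qed.

Lemma bochner_spec f g : weakly_measurable ip g ->
  {ae mu, forall x, f x = g x} -> (\int[mu]_x `|g x|%:E < +oo)%E ->
  [/\ bochner_integrable mu f,
      (`|bochner mu f|%:E <= \int[mu]_x `|g x|%:E)%E &
      forall h, (ip h (bochner mu f))%:E = (\int[mu]_x (ip h (g x))%:E)%E].
Proof.
move=> mg fg gfin; have [w0 gw0] := is_bochner_exists mg gfin.
have bf : is_bochner mu f (bochner mu f).
  by apply: xgetPex; exists w0; exact: is_bochner_ae gw0.
have [_ ipb] := is_bochner_ip bf mg fg.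
split => //; first by exists (bochner mu f).
exact: (weak_integral_norm_le H_separable mg).
Qed.

End BochnerPettis.

(** * Fubini and Tonelli for sigma-finite measures *)

(** The measures at hand are plain measures together with a proof of
    sigma-finiteness, whereas the theorems of Fubini and Tonelli expect the
    latter to be part of the structure. *)
Section SigmaFiniteFubini.
Context d1 d2 (T1 : measurableType d1) (T2 : measurableType d2) (R : realType).
Local Open Scope ereal_scope.

Lemma sigma_finite_pack d (T : measurableType d) (m : {measure set T -> \bar R}) :
  sigma_finite setT m ->
  exists m' : {sigma_finite_measure set T -> \bar R},
    m = m' :> {measure set T -> \bar R}.
Proof.
move=> s; have := sfinite_measure_sigma_finite s; case: m s => m c /= s sf.
pose m' : {sigma_finite_measure set T -> \bar R} := HB.pack m c
  (isSFinite.Build _ _ _ m sf) (isSigmaFinite.Build _ _ _ m s).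
by exists m'; congr Measure.Pack.
Qed.

Variables (m1 : {measure set T1 -> \bar R}) (m2 : {measure set T2 -> \bar R}).
Hypotheses (s1 : sigma_finite setT m1) (s2 : sigma_finite setT m2).

Lemma tonelli_sigma_finite (f : T1 * T2 -> \bar R) :
  measurable_fun setT f -> (forall z, 0 <= f z) ->
  \int[m1]_x \int[m2]_y f (x, y) = \int[m2]_y \int[m1]_x f (x, y).
Proof.
have [m1' ->] := sigma_finite_pack s1; have [m2' ->] := sigma_finite_pack s2.
exact: fubini_tonelli.
Qed.

Lemma measurable_integral2 (f : T1 * T2 -> \bar R) :
  measurable_fun setT f -> (forall z, 0 <= f z) ->
  measurable_fun setT (fun x => \int[m2]_y f (x, y)).
Proof.
have [m2' ->] := sigma_finite_pack s2.
exact: measurable_fun_fubini_tonelli_F.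
Qed.

Lemma fubini_sigma_finite (f : T1 * T2 -> \bar R) :
  measurable_fun setT f -> \int[m1]_x \int[m2]_y `|f (x, y)| < +oo ->
  \int[m1]_x \int[m2]_y f (x, y) = \int[m2]_y \int[m1]_x f (x, y).
Proof.
have [m1' ->] := sigma_finite_pack s1; have [m2' ->] := sigma_finite_pack s2.
by move=> mf /(integrable12ltyP m1' m2' mf); exact: Fubini.
Qed.

Lemma measurable_integral2_signed (f : T1 * T2 -> \bar R) :
  measurable_fun setT f ->
  measurable_fun setT (fun x => \int[m2]_y f (x, y)).
Proof.
move=> mf.
have mp : measurable_fun setT (fun x => \int[m2]_y f^\+ (x, y)).
  by apply: measurable_integral2 => //; exact: measurable_funepos.
have mn : measurable_fun setT (fun x => \int[m2]_y f^\- (x, y)).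
  by apply: measurable_integral2 => //; exact: measurable_funeneg.
have -> : (fun x => \int[m2]_y f (x, y)) = (fun x => \int[m2]_y f^\+ (x, y)) \-
    (fun x => \int[m2]_y f^\- (x, y)).
  apply/funext => x; rewrite [LHS]integralE; congr (_ - _);
    by apply: eq_integral => y _; rewrite ?funeposE ?funenegE.
exact: emeasurable_funB.
Qed.

End SigmaFiniteFubini.

(** * Fubini for Bochner integrals *)

Section VectorFubini.
Context {R : realType} {H : completeNormedModType R}.
Variable ip : inner_product H.
Hypothesis H_separable : separable_space H.
Context d1 d2 (T1 : measurableType d1) (T2 : measurableType d2).
Variables (m1 : {measure set T1 -> \bar R}) (m2 : {measure set T2 -> \bar R}).
Hypotheses (s1 : sigma_finite setT m1) (s2 : sigma_finite setT m2).
Local Open Scope ereal_scope.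

(** A Bochner integral depending on a parameter is, up to a null set of
    parameters, a weakly measurable function, to which Fubini's theorem applies
    after pairing with a vector. The integrand F only has to agree almost
    everywhere with a jointly measurable G; the weight rho makes the double
    integral finite even when the inner integrals are not integrable in x. *)
Lemma bochner_fubini (F : T1 -> T2 -> H) (G : T1 * T2 -> H) (rho : T1 -> R) :
  weakly_measurable ip G ->
  {ae m1, forall x, {ae m2, forall y, F x y = G (x, y)}} ->
  measurable_fun setT rho -> (forall x, (0 < rho x)%R) ->
  \int[m1]_x \int[m2]_y (rho x * `|G (x, y)|)%:E < +oo ->
  exists g : T1 -> H, [/\ weakly_measurable ip g,
    {ae m1, forall x, bochner m2 (F x) = g x},
    forall x, `|g x|%:E <= \int[m2]_y `|G (x, y)|%:E,
    \int[m1]_x (rho x * `|g x|)%:E < +oo &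
    forall h (phi : T1 -> R), measurable_fun setT phi ->
      {ae m1, forall x, `|phi x| <= rho x}%R ->
      \int[m1]_x (phi x * ip h (g x))%:E =
      \int[m2]_y \int[m1]_x (phi x * ip h (G (x, y)))%:E].
Proof.
move=> mG FG mrho rho0 Gfin.
have mGx x : weakly_measurable ip (fun y => G (x, y)).
  exact: (weakly_measurable_comp (pair1_measurable x)).
pose I x := \int[m2]_y `|G (x, y)|%:E.
have mI : measurable_fun setT I.
  apply: (measurable_integral2 s2 (f := fun z => `|G z|%:E)) => //.
  exact: (measurable_normrE H_separable).
have I0 x : 0 <= I x by exact: integral_ge0.
have rhoI x : \int[m2]_y (rho x * `|G (x, y)|)%:E = (rho x)%:E * I x.
  under eq_integral do rewrite EFinM.
  rewrite ge0_integralZl// ?lee_fin ?ltW//.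
  exact: (measurable_normrE H_separable).
have mrhoI : measurable_fun setT (fun x => (rho x)%:E * I x).
  by apply: emeasurable_funM => //; exact/measurable_EFinP.
have rhoI0 x : 0 <= (rho x)%:E * I x by rewrite mule_ge0// lee_fin ltW.
have {}Gfin : \int[m1]_x ((rho x)%:E * I x) < +oo.
  by under eq_integral do rewrite -rhoI.
pose A := [set x | I x < +oo].
have mA : measurable A by rewrite -[A]setTI; exact: emeasurable_fun_infty_o.
have aeA : {ae m1, forall x, A x}.
  have int_rhoI : m1.-integrable setT (fun x => (rho x)%:E * I x).
    by apply/integrableP; split => //; under eq_integral do rewrite gee0_abs//.
  apply: filterS (integrable_ae measurableT int_rhoI) => x /(_ Logic.I).
  rewrite /A /= ltey => rIfin; apply: contraTN rIfin => /eqP ->.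
  by rewrite gt0_muley ?lte_fin.
(* Setting g to 0 off A keeps it weakly measurable everywhere. *)
pose g x : H := (\1_A x : R) *: bochner m2 (fun y => G (x, y)).
have aerefl x : {ae m2, forall y, G (x, y) = G (x, y)} by exact: aeW.
have gA x : A x -> g x = bochner m2 (fun y => G (x, y)).
  by move=> Ax; rewrite /g indicE mem_set// scale1r.
have gN x : ~ A x -> g x = 0%R.
  by move=> Ax; rewrite /g indicE memNset// scale0r.
have mip h : measurable_fun setT (fun x => \int[m2]_y (ip h (G (x, y)))%:E).
  apply: (measurable_integral2_signed s2 (f := fun z => (ip h (G z))%:E)) => //.
  by apply/measurable_EFinP; exact: mG.
have mg : weakly_measurable ip g.
  move=> h; rewrite (_ : (fun x => _) = (fun x => \1_A x *
      fine (\int[m2]_y (ip h (G (x, y)))%:E))%R).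
    apply: measurable_funM; first exact: measurable_indic.
    exact: measurableT_comp (fine_measurable measurableT) (mip h).
  apply/funext => x; rewrite indicE; have [/set_mem Ax|] := boolP (x \in A).
    have [_ _ ipb] := bochner_spec H_separable (mGx x) (aerefl x) Ax.
    by rewrite gA// mul1r -ipb.
  by move=> /negP Ax; rewrite mul0r gN ?ip0// => /mem_set.
have gI x : `|g x|%:E <= I x.
  have [Ax|Ax] := pselect (A x); last by rewrite gN// normr0.
  have [_ + _] := bochner_spec H_separable (mGx x) (aerefl x) Ax.
  by rewrite gA.
exists g; split => //.
- apply: filterS2 aeA FG => x Ax FGx; rewrite gA//.
  have [_ _ ipF] := bochner_spec H_separable (mGx x) FGx Ax.
  have [_ _ ipG] := bochner_spec H_separable (mGx x) (aerefl x) Ax.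
  by apply: (ip_eqP (ip := ip)) => h; apply: EFin_inj; rewrite ipF ipG.
- apply: le_lt_trans Gfin; apply: ge0_le_integral => //.
  + by move=> x _; rewrite lee_fin mulr_ge0// ltW.
  + apply/measurable_EFinP/measurable_funM => //.
    exact: (measurable_normr H_separable mg).
  + by move=> x _; rewrite EFinM lee_wpmul2l// lee_fin ltW.
- move=> h phi mphi phirho.
  have mphiG : measurable_fun setT
      (fun z : T1 * T2 => (phi z.1 * ip h (G z))%:E).
    apply/measurable_EFinP; apply: measurable_funM; last exact: mG.
    exact: measurableT_comp mphi measurable_fst.
  rewrite -(fubini_sigma_finite s1 s2 (f := fun z => (phi z.1 * ip h (G z))%:E))//.
    apply: ae_eq_integral => //.
    + apply/measurable_EFinP/measurable_funM => //; exact: mg.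
    + exact: (measurable_integral2_signed s2
        (f := fun z => (phi z.1 * ip h (G z))%:E)).
    apply: filterS aeA => x Ax _; rewrite gA//.
    have [_ _ ipG] := bochner_spec H_separable (mGx x) (aerefl x) Ax.
    rewrite EFinM ipG -integralZl//.
    exact: (integrable_ip H_separable).
  apply: (@le_lt_trans _ _ (\int[m1]_x (`|h|%:E * ((rho x)%:E * I x)))).
    apply: ge0_ae_le_integralT.
    + by move=> x; apply: integral_ge0.
    + by move=> x; rewrite mule_ge0.
    apply: filterS phirho => x phirho.
    rewrite -rhoI -ge0_integralZl//; last 2 first.
    + apply/measurable_EFinP/measurable_funM => //.
      exact: (measurable_normr H_separable (mGx x)).
    + by move=> y _; rewrite lee_fin mulr_ge0// ltW.
    apply: ge0_le_integral => //.
    + apply/measurable_EFinP/measurableT_comp => //.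
      by apply: (measurable_funM (f := fun=> phi x)) => //; exact: mGx.
    + apply: measurable_funeM; apply/measurable_EFinP/measurable_funM => //.
      exact: (measurable_normr H_separable (mGx x)).
    move=> y _; rewrite -EFinM abse_EFin lee_fin normrM mulrCA.
    by rewrite ler_pM// cauchy_schwarz.
  by rewrite ge0_integralZl// lte_mul_pinfty.
Qed.

End VectorFubini.

(** * Translation on the half-line *)

Section HalfLine.
Context {R : realType}.
Local Notation leb := (@lebesgue_measure R).
Local Notation hl := (@half_line R).
Local Open Scope ereal_scope.

Lemma lebesgue_measure_shift (s : R) (A : set R) : measurable A ->
  leb ((fun x => (x - s)%R) @^-1` A) = leb A.
Proof.
move=> mA.
have ms : measurable_fun setT (fun x : measurableTypeR R => (x - s)%R : measurableTypeR R).
  exact: measurable_funB.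
pose mf := @isMeasurableFun.Build _ _ _ _ _ ms.
pose shiftf : {mfun measurableTypeR R >-> measurableTypeR R} :=
  HB.pack (fun x : measurableTypeR R => (x - s)%R : measurableTypeR R) mf.
apply/esym; apply: (lebesgue_measure_unique (mu := pushforward leb shiftf)) => //.
move=> _ [[a b]] _ <-; rewrite /pushforward /=.
rewrite [RHS](_ : _ = leb `](a + s)%R, (b + s)%R]%classic); last first.
  rewrite /pushforward; congr (leb _).
  by apply/seteqP; split=> x /=; rewrite !in_itv /= ltrBrDr lerBlDr.
rewrite !lebesgue_measure_itv /= !lte_fin ltrD2r; case: ifPn => // _.
by rewrite -!EFinB; congr EFin; ring.
Qed.

Lemma half_lineE (A : set R) : A `<=` `[0%R, +oo[%classic -> hl A = leb A.
Proof. by move=> /setIidPl A0; congr (leb _). Qed.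

Lemma half_line_sigma_finite : sigma_finite setT hl.
Proof.
have [F FT Ffin] := @sigma_finiteT _ _ _ leb.
exists F => // n; have [mFn Fn] := Ffin n; split => //.
apply: le_lt_trans Fn; apply: le_measure; rewrite ?inE//.
exact: measurableI.
Qed.

Lemma half_line_null (A : set R) : measurable A -> leb A = 0 -> hl A = 0.
Proof.
move=> mA A0; apply/eqP; rewrite -measure_le0 -A0.
by apply: le_measure; rewrite ?inE//; exact: measurableI.
Qed.

#[export] Instance ae_half_line_filter : Filter (nbhs (almost_everywhere hl)).
Proof. exact: ae_filter_ringOfSetsType. Qed.

Lemma ae_half_line_ge0 : {ae hl, forall x : R, (0 <= x)%R}.
Proof.
exists `]-oo, 0%R[%classic; split => //.
  rewrite -(measure0 leb); congr (leb _).
  apply/seteqP; split=> x //=; rewrite !in_itv /= andbT => -[x0].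
  by rewrite leNgt x0.
by move=> x /= /negP; rewrite in_itv /= -ltNge.
Qed.

Lemma ae_half_line_neq (a : R) : {ae hl, forall x : R, x != a}.
Proof.
exists [set a]; split; first exact: measurable_set1.
  apply: half_line_null; first exact: measurable_set1.
  exact: lebesgue_measure_set1.
by move=> x /= /negP; rewrite negbK => /eqP.
Qed.

Lemma half_line_integral (f : R -> \bar R) : (forall x, 0 <= f x) ->
  \int[hl]_x f x = \int[leb]_(x in `[0%R, +oo[) f x.
Proof.
move=> f0; rewrite -(@eq_measure_integral _ _ _ _ leb hl); last first.
  by move=> A mA A0; rewrite [LHS]half_lineE.
rewrite [RHS]integral_mkcond; apply: ge0_ae_eq_integralT => //.
  by move=> x; exact: erestrict_ge0.
apply: filterS ae_half_line_ge0 => x x0.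
by rewrite patchE mem_set//= in_itv /= x0.
Qed.

Lemma half_line_shift_ge0 (f : R -> \bar R) (s : R) :
  measurable_fun setT f -> (forall x, 0 <= f x) ->
  (forall x, (x < 0)%R -> f x = 0) -> (0 <= s)%R ->
  \int[hl]_r f (r - s)%R = \int[hl]_r f r.
Proof.
move=> mf f0 fN s0.
have ms : measurable_fun setT (fun x : measurableTypeR R => (x - s)%R : measurableTypeR R).
  exact: measurable_funB.
pose mfs := @isMeasurableFun.Build _ _ _ _ _ ms.
pose shiftf : {mfun measurableTypeR R >-> measurableTypeR R} :=
  HB.pack (fun x : measurableTypeR R => (x - s)%R : measurableTypeR R) mfs.
pose D : set (measurableTypeR R) := `[0%R, +oo[%classic.
have mD : measurable D by exact: measurable_itv.
transitivity (\int[hl]_(r in shiftf @^-1` D) (f \o shiftf) r).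
  rewrite [RHS]integral_mkcond; apply: eq_integral => x _.
  rewrite patchE; case: ifPn => //; rewrite notin_setE /= /D /= in_itv /= andbT.
  by move=> /negP; rewrite -ltNge => /fN.
rewrite -ge0_integral_pushforward//; last first.
  exact: measurable_funS mf.
rewrite (@eq_measure_integral _ _ _ _ hl (pushforward hl shiftf)); last first.
  move=> A mA AD; rewrite [RHS]half_lineE// -[RHS](lebesgue_measure_shift s)//.
  rewrite /pushforward [LHS]half_lineE// => x /AD /=.
  by rewrite /D /= !in_itv /= !andbT subr_ge0; exact: le_trans.
rewrite [LHS]integral_mkcond; apply: eq_integral => x _.
rewrite patchE; case: ifPn => //; rewrite notin_setE /D /= in_itv /= andbT.
by move=> /negP; rewrite -ltNge => /fN.
Qed.

(** Translation invariance for functions that vanish on the negative axis, which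
    is how the shift U_s acts. *)
Lemma half_line_shift (f : R -> \bar R) (s : R) :
  measurable_fun setT f -> (forall x, (x < 0)%R -> f x = 0) -> (0 <= s)%R ->
  \int[hl]_r f (r - s)%R = \int[hl]_r f r.
Proof.
move=> mf fN s0; rewrite integralE [RHS]integralE; congr (_ - _).
  rewrite -(half_line_shift_ge0 (f := f^\+) _ _ _ s0)//.
  - by apply: eq_integral => x _; rewrite !funeposE.
  - exact: measurable_funepos.
  - by move=> x /fN; rewrite funeposE => ->; rewrite maxxx.
rewrite -(half_line_shift_ge0 (f := f^\-) _ _ _ s0)//.
- by apply: eq_integral => x _; rewrite !funenegE.
- exact: measurable_funeneg.
- by move=> x /fN; rewrite funenegE => ->; rewrite oppe0 maxxx.
Qed.

End HalfLine.

(** * The Laplace transform of the kernel *)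

Section KernelLaplace.
Context {R : realType}.
Local Notation leb := (@lebesgue_measure R).
Local Notation hl := (@half_line R).
Local Open Scope ereal_scope.

Lemma half_line_exp_lt (l t : R) : (0 < l)%R -> (0 < t)%R ->
  \int[hl]_x (\1_`]-oo, t[ x * (l * expR (- l * x)))%:E =
  (1 - expR (- l * t))%:E.
Proof.
move=> l0 t0; rewrite half_line_integral; last first.
  by move=> x; rewrite lee_fin !mulr_ge0 ?expR_ge0// ?ltW// indicE.
transitivity (\int[leb]_(x in `[0%R, t[) (exponential_pdf l x)%:E).
  rewrite integral_mkcond [RHS]integral_mkcond; apply: eq_integral => x _.
  rewrite !patchE !indicE !mem_setE !in_itv /= andbT.
  have [x0|x0] := leP 0%R x; last by [].
  by rewrite exponential_pdfE//=; case: (x < t)%R; rewrite ?mul1r ?mul0r.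
rewrite -[RHS](exponential_prob_itv0c l t0).
apply: (integral_itv_bndo_bndc (a := BLeft 0%R)
  (f := fun x => (exponential_pdf l x)%:E)).
apply: measurable_funTS; apply/measurable_EFinP.
exact: measurable_exponential_pdf.
Qed.

Lemma half_line_exp (l : R) : (0 < l)%R ->
  \int[hl]_x (expR (- l * x))%:E = (l^-1)%:E.
Proof.
move=> l0; rewrite half_line_integral; last first.
  by move=> x; rewrite lee_fin expR_ge0.
transitivity (\int[leb]_(x in `[0%R, +oo[) (l^-1%:E * (exponential_pdf l x)%:E)).
  apply: eq_integral => x; rewrite inE /= in_itv /= andbT => x0.
  by rewrite exponential_pdfE// -EFinM mulrA mulVf ?mul1r// gt_eqF.
rewrite ge0_integralZl//.
- rewrite integral_mkcond -[RHS]mule1; congr (_ * _).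
  rewrite -(integral_exponential_pdf l0); apply: eq_integral => x _.
  rewrite patchE mem_setE in_itv /= andbT; case: leP => // x0.
  by rewrite lt0_exponential_pdf.
- apply: measurable_funTS; apply/measurable_EFinP.
  exact: measurable_exponential_pdf.
- by move=> x _; rewrite lee_fin exponential_pdf_ge0 ?ltW.
- by rewrite lee_fin invr_ge0 ltW.
Qed.

Variable k : R -> R.
Hypothesis k_adm : admissible_kernel k.

(** The kernel extended by 0, so that the integral over the moving interval from
    0 to t becomes a convolution on the line. *)
Definition causal_kernel (x : R) : R := if (0 < x)%R then k x else 0%R.
Local Notation ck := causal_kernel.

Lemma causal_kernel_ge0 x : (0 <= ck x)%R.
Proof. by rewrite /ck; case: ifP => // x0; exact: (kernel_ge0 k_adm). Qed.

Lemma measurable_causal_kernel : measurable_fun setT ck.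
Proof.
pose D := `]0%R, +oo[%classic : set R.
have mD : measurable D by exact: measurable_itv.
rewrite (_ : ck = k \_ D); last first.
  apply/funext => x; rewrite patchE /ck /D mem_setE in_itv /= andbT.
  by [].
apply/(measurable_restrict k mD measurableT); rewrite setTI.
apply: (measurability (@RGenCInfty.G R)) => [|/= _ [_] [r] -> <-].
  exact: RGenCInfty.measurableE.
apply: is_interval_measurable => s t /=.
rewrite /D /= !in_itv /= !andbT => -[s0 ks] [t0 kt] u /andP[su ut].
have u0 := lt_le_trans s0 su.
by rewrite !in_itv /= !andbT; split => //; rewrite (le_trans kt)// (kernel_nincr k_adm).
Qed.

(** Near 0 the kernel is integrable by assumption, and beyond 1 it is bounded by
    k 1. *)
Lemma kernel_laplace_fin (l : R) : (0 < l)%R ->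
  \int[hl]_x (expR (- l * x) * ck x)%:E < +oo.
Proof.
move=> l0; have mk := measurable_causal_kernel.
have mexp : measurable_fun setT (fun x : R => expR (- l * x)).
  by apply: measurableT_comp => //; exact: mulrl_measurable.
have k1 : (0 <= k 1)%R by exact: (kernel_ge0 k_adm).
have mi : measurable_fun setT (\1_`[0%R, 1%R] : R -> R).
  by apply: measurable_indic; exact: measurable_itv.
apply: (@le_lt_trans _ _ (\int[hl]_x ((\1_`[0%R, 1%R] x * ck x)%:E +
    (k 1)%:E * (expR (- l * x))%:E))).
  apply: ge0_ae_le_integralT.
  - by move=> x; rewrite lee_fin mulr_ge0 ?expR_ge0 ?causal_kernel_ge0.
  - move=> x; rewrite adde_ge0 ?mule_ge0// ?lee_fin ?expR_ge0//.
    by rewrite mulr_ge0 ?causal_kernel_ge0// indicE.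
  apply: filterS ae_half_line_ge0 => x x0.
  rewrite -EFinM -EFinD lee_fin indicE mem_setE in_itv /= x0 /=.
  have k0 := causal_kernel_ge0 x; have e0 := expR_ge0 (- l * x).
  have [x1|x1] := leP x 1%R; rewrite /= ?mul1r ?mul0r ?add0r.
    have e1 : (expR (- l * x) <= 1)%R.
      by rewrite -expR0 ler_expR mulNr oppr_le0 mulr_ge0// ltW.
    by rewrite (@le_trans _ _ (ck x))// ?ler_piMl// lerDl mulr_ge0.
  rewrite mulrC ler_wpM2r// /ck (lt_trans _ x1)//.
  by apply: (kernel_nincr k_adm) => //; exact: ltW.
rewrite ge0_integralD//.
- rewrite ge0_integralZl//; last by apply/measurable_EFinP.
  rewrite half_line_exp// lte_add_pinfty//; last by rewrite -EFinM ltry.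
  rewrite half_line_integral; last first.
    by move=> x; rewrite lee_fin mulr_ge0 ?causal_kernel_ge0// indicE.
  have /integrableP[_] := kernel_L1loc k_adm (@ltr01 R).
  apply: le_lt_trans.
  rewrite integral_mkcond [leRHS]integral_mkcond.
  apply: ge0_ae_le_integralT.
  + move=> x; apply: erestrict_ge0 => y _.
    by rewrite lee_fin mulr_ge0 ?causal_kernel_ge0// indicE.
  + by move=> x; apply: erestrict_ge0 => y _; rewrite abse_ge0.
  apply: aeW => x; rewrite !patchE !mem_setE !in_itv /= andbT indicE.
  rewrite mem_setE in_itv /=; have [x0|x0] := leP 0%R x; rewrite /= ?mul0r//.
  have [x1|x1] := leP x 1%R; rewrite /= ?mul0r ?lexx// mul1r.
  rewrite lee_fin /ck; case: ifP => // _; exact: ler_norm.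
- by move=> x _; rewrite lee_fin mulr_ge0 ?causal_kernel_ge0// indicE.
- by apply/measurable_EFinP; exact: measurable_funM.
- by move=> x _; rewrite -EFinM lee_fin mulr_ge0 ?expR_ge0.
- by apply: measurable_funeM; exact/measurable_EFinP.
Qed.

Variable M : {measure set (measurableTypeR R) -> \bar R}.
Hypothesis M_tail : tail_measure k M.

(** M gives mass k (1 / (n + 1)) to the half-line beyond 1 / (n + 1), which is
    finite although M itself may be infinite near 0. *)
Lemma tail_measure_sigma_finite : sigma_finite setT M.
Proof.
have [M0 Mk] := M_tail.
exists (fun n => `]-oo, 0%R] `|` `](n.+1%:R^-1)%R, +oo[)%classic => [|n].
  apply/seteqP; split => // x _; have [x0|x0] := leP x 0%R.
    by exists 0%N => //; left; rewrite /= in_itv.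
  have [N _ /(_ _ (leqnn N)) NP] := near_infty_natSinv_lt (PosNum x0).
  by exists N => //; right; rewrite /= in_itv /= andbT.
split; first exact: measurableU.
apply: (@le_lt_trans _ _ (M `]-oo, 0%R]%classic + M `](n.+1%:R^-1)%R, +oo[%classic)).
  exact: measureU2.
by rewrite [X in X + _]M0 add0e Mk ?ltry// invr_gt0.
Qed.

(** Write 1 - exp (- l tau) as the integral of l exp (- l x) over 0 < x < tau and
    exchange the integrals: the mass of the tau beyond x is k x. *)
Lemma laplace_exponent_kernel (l : R) : (0 < l)%R ->
  (laplace_exponent M l)%:E = \int[hl]_x (l * (expR (- l * x) * ck x))%:E.
Proof.
move=> l0; have [M0 Mk] := M_tail.
pose f (z : R * R) : \bar R :=
  (\1_[set z : R * R | (z.2 < z.1)%R] z * (\1_`]0%R, +oo[ z.2 * (l * expR (- l * z.2))))%:E.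
have f0 z : 0 <= f z.
  by rewrite lee_fin !mulr_ge0 ?expR_ge0 ?indicE// ltW.
have mexp : measurable_fun setT (fun x : R => l * expR (- l * x))%R.
  apply: measurable_funM => //.
  by apply: measurableT_comp => //; exact: mulrl_measurable.
have indlt x y : \1_[set z : R * R | (z.2 < z.1)%R] (x, y) = ((y < x)%R%:R : R).
  by rewrite indicE; congr (nat_of_bool _)%:R; apply/idP/idP; rewrite inE.
have mf : measurable_fun setT f.
  apply/measurable_EFinP/measurable_funM.
    apply: measurable_indic.
    have := @measurable_fun_ltr _ (measurableTypeR R * measurableTypeR R)%type R
      setT snd fst measurable_snd measurable_fst.
    by move=> /(_ measurableT [set true] I); rewrite setTI.
  apply: (measurableT_comp (f := fun x : R => (\1_`]0%R, +oo[ x * (l * expR (- l * x)))%R)); last exact: measurable_snd.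
  by apply: measurable_funM => //; apply: measurable_indic; exact: measurable_itv.
have := tonelli_sigma_finite tail_measure_sigma_finite half_line_sigma_finite mf f0.
have -> : \int[M]_x \int[hl]_y f (x, y) =
    \int[M]_(x in `]0%R, +oo[) (1 - expR (- l * x))%:E.
  rewrite [RHS]integral_mkcond; apply: eq_integral => x _.
  rewrite patchE mem_setE in_itv /= andbT; case: ltP => x0.
    rewrite -half_line_exp_lt//; apply: ge0_ae_eq_integralT => //.
      by move=> y; rewrite lee_fin !mulr_ge0 ?expR_ge0 ?indicE// ltW.
    apply: filterS2 ae_half_line_ge0 (ae_half_line_neq 0%R) => y y0 yN0.
    rewrite /f /= indlt !indicE !mem_setE !in_itv /= andbT.
    by rewrite lt_neqAle eq_sym yN0 y0 mul1r.
  apply: integral0_eq => y _; rewrite /f /= indlt !indicE !mem_setE /= in_itv /= andbT.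
  case: (ltP 0%R y) => y0; last by rewrite mul0r mulr0.
  by rewrite ltNge (le_trans x0 (ltW y0)) mul0r.
have -> : \int[hl]_y \int[M]_x f (x, y) =
    \int[hl]_x (l * (expR (- l * x) * ck x))%:E.
  apply: eq_integral => y _.
  rewrite /f /= /ck indicE mem_setE in_itv /= andbT; case: ltP => y0; last first.
    by rewrite integral0_eq ?mulr0// => x _; rewrite mul0r mulr0.
  under eq_integral do rewrite indlt mul1r EFinM muleC.
  have -> : (fun x => (l * expR (- l * y))%:E * ((y < x)%R%:R)%:E) =
      (fun x => (l * expR (- l * y))%:E * (\1_`]y, +oo[ x)%:E).
    by apply/funext => x; rewrite !indicE !mem_setE in_itv /= andbT.
  rewrite ge0_integralZl//.
  - by rewrite integral_indic// setIT Mk// -EFinM mulrA.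
  - by apply/measurable_EFinP/measurable_indic.
  - by rewrite lee_fin mulr_ge0 ?expR_ge0// ltW.
rewrite /laplace_exponent /Rintegral => ->; rewrite fineK//.
under eq_integral do rewrite EFinM.
rewrite ge0_integralZl//.
- by rewrite fin_numM// ge0_fin_numE ?kernel_laplace_fin// integral_ge0// => x _;
    rewrite lee_fin mulr_ge0 ?expR_ge0// causal_kernel_ge0.
- apply/measurable_EFinP/measurable_funM; last exact: measurable_causal_kernel.
  by apply: measurableT_comp => //; exact: mulrl_measurable.
- by move=> x _; rewrite lee_fin mulr_ge0 ?expR_ge0// causal_kernel_ge0.
- by rewrite lee_fin ltW.
Qed.

End KernelLaplace.

(** * Weierstrass' theorem *)

Section Weierstrass.
Context {R : realType}.
Implicit Types (f g : nat -> R) (y : R).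

(** The expectation of f k for k binomial with parameters n and y, by recursion
    on the first trial: this avoids binomial coefficients altogether. *)
Fixpoint bernstein_mean y n f : R :=
  if n is m.+1 then
    y * bernstein_mean y m (fun k => f k.+1) + (1 - y) * bernstein_mean y m f
  else f 0%N.

Fixpoint bernstein_poly n f : {poly R} :=
  if n is m.+1 then
    'X * bernstein_poly m (fun k => f k.+1) + (1 - 'X) * bernstein_poly m f
  else (f 0%N)%:P.

Lemma horner_bernstein y n f : (bernstein_poly n f).[y] = bernstein_mean y n f.
Proof.
by elim: n f => [|n ih] f /=; rewrite ?hornerE// !ih.
Qed.

Lemma bernstein_mean_cst y n c : bernstein_mean y n (fun=> c) = c.
Proof. by elim: n => //= n ->; ring. Qed.

Lemma bernstein_meanD y n f g :
  bernstein_mean y n (fun k => f k + g k) =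
  bernstein_mean y n f + bernstein_mean y n g.
Proof. by elim: n f g => //= n ih f g; rewrite !ih; ring. Qed.

Lemma bernstein_meanZ y n c f :
  bernstein_mean y n (fun k => c * f k) = c * bernstein_mean y n f.
Proof. by elim: n f => //= n ih f; rewrite !ih; ring. Qed.

Lemma bernstein_mean_le y n f g : 0 <= y <= 1 ->
  (forall k, (k <= n)%N -> f k <= g k) ->
  bernstein_mean y n f <= bernstein_mean y n g.
Proof.
move=> /andP[y0 y1]; elim: n f g => [|n ih] f g fg /=; first exact: fg.
by rewrite lerD// ler_wpM2l ?subr_ge0// ih// => k kn; apply: fg => //; exact: leqW.
Qed.

(** The second moment about an arbitrary point a; at a = n y it is the variance
    of the binomial distribution. General a is what the induction needs. *)
Lemma bernstein_mean_sqr y n a :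
  bernstein_mean y n (fun k => (k%:R - a) ^+ 2) =
  (n%:R * y - a) ^+ 2 + n%:R * y * (1 - y).
Proof.
elim: n a => [|n ih] a /=; first by ring.
rewrite ih (_ : (fun k => _) = fun k => (k%:R - (a - 1)) ^+ 2).
  by rewrite ih -natr1; ring.
by apply/funext => k; rewrite -natr1; ring.
Qed.

(** Uniform continuity on the unit interval, by compactness. *)
Lemma heine (q : R -> R) (eps : R) : continuous q -> 0 < eps ->
  exists2 d, 0 < d & forall x y, 0 <= x <= 1 -> `|x - y| < d ->
    `|q x - q y| < eps.
Proof.
move=> cq eps0.
have /compact_near_coveringP K := @segment_compact R 0 1.
have := K _ (0 : R)^'+ (fun d x => forall y, `|x - y| < d -> `|q x - q y| < eps).
move=> /(_ _ _)[].
  move=> x _.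
  have e2 : 0 < eps / 2 by rewrite divr_gt0.
  have /cvgrPdist_lt/(_ _ e2)/nbhs_ballP[r /= r0 qr] := cq x.
  have r2 : 0 < r / 2 by rewrite divr_gt0.
  exists (ball x (r / 2), [set d | d < r / 2]) => /=.
    by split; [exact: nbhsx_ballx|exact: nbhs_right_lt].
  move=> [x' d] /= [xx' dr] y x'y.
  have b1 : ball x r x' by apply: le_ball xx'; rewrite ler_pdivrMr// ler_peMr ?ltW// ltr1n.
  have b2 : ball x r y.
    rewrite [r]splitr; apply: ball_triangle xx' _.
    by rewrite -ball_normE /=; exact: lt_trans dr.
  rewrite [eps]splitr -(subrK (q x) (q x')) -addrA (le_lt_trans (ler_normD _ _))//.
  by rewrite ltrD ?qr// distrC qr.
move=> d /= d0 dP.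
exists (d / 2) => [|x y x01 xy]; first by rewrite divr_gt0.
apply: (dP (d / 2)) => //=.
  by rewrite sub0r normrN ger0_norm ?ltW ?divr_gt0// ltr_pdivrMr// ltr_pMr// ltr1n.
by rewrite divr_gt0.
Qed.

(** Bernstein's proof: by uniform continuity and boundedness, the oscillation of
    q is at most eps / 2 + C (y - x)^2 for a large constant C, and the binomial
    average of the last term is at most C / n. *)
Lemma weierstrass (q : R -> R) (eps : R) : continuous q -> 0 < eps ->
  exists p : {poly R}, forall y, 0 <= y <= 1 -> `|q y - p.[y]| <= eps.
Proof.
move=> cq eps0.
have e2 : 0 < eps / 2 by rewrite divr_gt0.
have [d d0 qd] := heine cq e2.
have cqn : {within `[(0:R), 1], continuous (fun x => `|q x|)}.
  by apply: continuous_subspaceT => x; apply: cvg_norm; exact: cq.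
have [c _ qc] := EVT_max ler01 cqn.
pose K := `|q c|.
have qK x : 0 <= x <= 1 -> `|q x| <= K by move=> x01; apply: qc; rewrite in_itv.
have K0 : 0 <= K by exact: normr_ge0.
(* Points at distance at least d are covered by the quadratic term alone. *)
pose C := 2 * K / d ^+ 2.
have C0 : 0 <= C by apply: divr_ge0; [exact: mulr_ge0|exact: sqr_ge0].
have gap x y : 0 <= x <= 1 -> 0 <= y <= 1 ->
    `|q x - q y| <= eps / 2 + C * (y - x) ^+ 2.
  move=> x01 y01; have [xyd|xyd] := ltP `|x - y| d.
    by rewrite (le_trans (ltW (qd _ _ x01 xyd)))// lerDl mulr_ge0// sqr_ge0.
  rewrite (le_trans (ler_normB _ _))// (@le_trans _ _ (K + K))//.
    by rewrite lerD// qK.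
  have -> : K + K = C * d ^+ 2.
    by rewrite /C divfK ?expf_neq0 ?gt_eqF//; ring.
  rewrite -[leLHS]add0r lerD ?(ltW e2)// ler_wpM2l//.
  rewrite -[leRHS]real_normK ?num_real// distrC.
  by rewrite ler_sqr ?nnegrE ?(ltW d0).
have [n _ nP] := near_infty_natSinv_lt (PosNum (divr_gt0 e2 (ltr_wpDl C0 (@ltr01 R)))).
have {nP} := nP n (leqnn n) => /= nP.
exists (bernstein_poly n.+1 (fun k => q (k%:R / n.+1%:R))) => y y01.
rewrite horner_bernstein.
have n0 : 0 < n.+1%:R :> R by [].
set E := bernstein_mean y n.+1.
have E1 : E (fun k => q y - q (k%:R / n.+1%:R)) = q y - E (fun k => q (k%:R / n.+1%:R)).
  have -> : (fun k => q y - q (k%:R / n.+1%:R)) =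
      (fun k => q y + (-1) * q (k%:R / n.+1%:R)).
    by apply/funext => k; rewrite mulN1r.
  rewrite /E (bernstein_meanD _ _ (fun=> q y)) bernstein_mean_cst.
  by rewrite (bernstein_meanZ _ _ _ (fun k => q (k%:R / n.+1%:R))) mulN1r.
rewrite -E1.
pose bound k := eps / 2 + C / n.+1%:R ^+ 2 * (k%:R - n.+1%:R * y) ^+ 2.
have kb k : (k <= n.+1)%N -> `|q y - q (k%:R / n.+1%:R)| <= bound k.
  move=> kn; have k01 : 0 <= (k%:R / n.+1%:R : R) <= 1.
    by rewrite divr_ge0// ler_pdivrMr// mul1r ler_nat.
  rewrite (le_trans (gap _ _ y01 k01))// /bound lerD2l.
  have -> : k%:R / n.+1%:R - y = (k%:R - n.+1%:R * y) / n.+1%:R.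
    by field; rewrite gt_eqF.
  by rewrite exprMn exprVn mulrCA mulrC mulrA.
have Eb : E bound <= eps.
  rewrite /E /bound (bernstein_meanD _ _ (fun=> eps / 2)) bernstein_mean_cst.
  rewrite bernstein_meanZ bernstein_mean_sqr subrr expr0n /= add0r.
  have yy : y * (1 - y) <= 1 by move: y01 => /andP[y0 y1]; nra.
  rewrite [leRHS]splitr lerD2l.
  have -> : C / n.+1%:R ^+ 2 * (n.+1%:R * y * (1 - y)) =
      C * (y * (1 - y)) / n.+1%:R by field; rewrite gt_eqF.
  move: nP; rewrite ltr_pdivlMr ?ltr_wpDl// => nP.
  apply: le_trans (ltW nP); rewrite [leLHS]mulrC.
  apply: ler_wpM2l; first by rewrite invr_ge0 ltW.
  by apply: (@le_trans _ _ C); [exact: ler_piMr|rewrite lerDl].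
rewrite ler_norml; apply/andP; split.
  rewrite lerNl (le_trans _ Eb)// -mulN1r -bernstein_meanZ.
  apply: bernstein_mean_le => // k /kb; rewrite mulN1r; apply: le_trans.
  by rewrite -normrN ler_norm.
apply: le_trans Eb; apply: bernstein_mean_le => // k /kb; apply: le_trans.
exact: ler_norm.
Qed.

End Weierstrass.

(** * Test functions as limits of exponential sums *)

Section ExponentialApproximation.
Context {R : realType}.

Definition exp_sum n (c : nat -> R) (x : R) : R :=
  \sum_(i < n) c i * expR (- i.+1%:R * x).

Lemma is_derive_expM (a x : R) :
  is_derive x 1 (fun y : R => expR (a * y)) (a * expR (a * x)).
Proof.
have dM : is_derive x 1 (fun y : R => a * y) a.
  by apply: is_derive_eq (is_deriveZ a (is_derive_id x 1)) _; rewrite /GRing.scale /= mulr1.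
by apply: is_derive_eq (is_derive1_comp (is_derive_expR _) dM) _; rewrite mulrC.
Qed.

Lemma exp_sumS n c :
  exp_sum n.+1 c = (fun x => exp_sum n c x + c n * expR (- n.+1%:R * x)).
Proof. by apply/funext => x; rewrite /exp_sum big_ord_recr. Qed.

Lemma exp_sum0 c : exp_sum 0 c = cst 0.
Proof. by apply/funext => x; rewrite /exp_sum big_ord0. Qed.

Lemma is_derive_exp_sum n c (x : R) :
  is_derive x 1 (exp_sum n c) (- exp_sum n (fun i => i.+1%:R * c i) x).
Proof.
elim: n => [|n ih]; first by rewrite !exp_sum0 oppr0; exact: is_derive_cst.
rewrite !exp_sumS.
apply: is_derive_eq (is_deriveD ih (is_deriveZ (c n) (is_derive_expM _ _))) _.
by rewrite /GRing.scale /=; ring.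
Qed.

Lemma exp_sum_cvg0 n c : exp_sum n c x @[x --> +oo] --> 0.
Proof.
elim: n => [|n ih]; first by rewrite exp_sum0; exact: cvg_cst.
rewrite exp_sumS.
rewrite -[X in _ --> X]addr0; apply: cvgD => //.
rewrite -[X in _ --> X](mulr0 (c n)); apply: cvgMl_tmp.
under eq_fun do rewrite mulNr.
apply: (@cvg_comp _ _ _ (fun x : R => n.+1%:R * x) (fun x => expR (- x)) _ +oo).
  exact: gt0_cvgMry.
exact: cvgr_expR.
Qed.

Lemma exp_sum_poly (p : {poly R}) (x : R) :
  expR (- x) * p.[expR (- x)] = exp_sum (size p) (fun i => p`_i) x.
Proof.
rewrite horner_coef mulr_sumr; apply: eq_bigr => i _.
rewrite mulrCA -exprS -expRM_natl; congr (_ * expR _); ring.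
Qed.

Variable phi : R -> R.
Hypothesis phi_test : test_function phi.

Lemma test_function_derivable (x : R) : derivable phi x 1.
Proof. by have [/(_ 0%N x)] := phi_test. Qed.

Lemma continuous_test_function : continuous phi.
Proof.
move=> x; apply: differentiable_continuous; apply/derivable1_diffP.
exact: test_function_derivable.
Qed.

Lemma continuous_derive1_test_function : continuous phi^`()%classic.
Proof.
move=> x; apply: differentiable_continuous; apply/derivable1_diffP.
by have [/(_ 1%N x)] := phi_test.
Qed.

Lemma derive1_test_function0 : exists2 B, 0 <= B & forall x, B < x ->
  phi x = 0 /\ phi^`()%classic x = 0.
Proof.
have [_ [B BP]] := phi_test; exists (Num.max B 0).
  by rewrite le_max lexx orbT.
move=> x; rewrite gt_max => /andP[Bx x0]; split.
  by apply: BP; rewrite gtr0_norm.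
rewrite derive1E (@near_eq_derive _ _ _ _ (cst 0)) ?derive_cst//.
near=> y; apply: BP; rewrite (lt_le_trans _ (ler_norm _))//.
near: y; exact: lt_nbhsr.
Unshelve. all: by end_near. Qed.

(** In the variable y = exp (- x), the function phi' (x) exp x extends to a
    continuous function of y in the unit interval, vanishing near 0, so that
    Weierstrass' theorem approximates it by a polynomial p. Then phi' (x) is
    within eps exp (- x) of exp (- x) p (exp (- x)), a sum of exponentials.
    Integrating from infinity gives the same bound for phi and the corresponding
    primitive. *)
Lemma exp_sum_approx (eps : R) : 0 < eps -> exists n c,
  (forall x, 0 <= x ->
    `|phi^`()%classic x + exp_sum n (fun i => i.+1%:R * c i) x| <=
      eps * expR (- x)) /\
  (forall x, 0 <= x -> `|phi x - exp_sum n c x| <= eps * expR (- x)).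
Proof.
move=> eps0; have [B B0 BP] := derive1_test_function0.
pose q y := if 0 < y then phi^`()%classic (- ln y) / y else 0.
have cq : continuous q.
  move=> y; have [y0|y0] := ltP 0 y.
    have nq : \forall z \near y, phi^`()%classic (- ln z) / z = q z.
      by near=> z; rewrite /q ifT//; near: z; exact: lt_nbhsr.
    apply: cvg_trans (near_eq_cvg nq) _; rewrite /q y0.
    apply: cvgM.
      apply: (@continuous_comp _ _ _ (fun z => - ln z) phi^`()%classic).
        apply: cvgN; exact: continuous_ln.
      exact: continuous_derive1_test_function.
    by apply: cvgV; [rewrite gt_eqF|exact: cvg_id].
  have q0 z : z < expR (- B) -> q z = 0.
    move=> zB; rewrite /q; case: ifPn => // z0.
    have [|_ ->] := BP (- ln z); last by rewrite mul0r.
    by rewrite ltrNr -ltr_expR lnK.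
  have nq : \forall z \near y, cst 0 z = q z.
    near=> z; apply/esym/q0; near: z; apply: lt_nbhsl.
    exact: le_lt_trans (expR_gt0 _).
  apply: cvg_trans (near_eq_cvg nq) _; rewrite q0; first exact: cvg_cst.
  exact: le_lt_trans (expR_gt0 _).
have [p qp] := weierstrass cq eps0.
(* The primitive of p`_i exp (- (i + 1) x) that vanishes at infinity. *)
pose n := size p; pose c i := - p`_i / i.+1%:R.
have cE x : exp_sum n (fun i => i.+1%:R * c i) x = - (expR (- x) * p.[expR (- x)]).
  rewrite exp_sum_poly -sumrN; apply: eq_bigr => i _.
  by rewrite /c mulrC mulrA; field; rewrite gt_eqF.
have d1 x : 0 <= x -> `|phi^`()%classic x + exp_sum n (fun i => i.+1%:R * c i) x|
    <= eps * expR (- x).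
  move=> x0; have := qp (expR (- x)).
  rewrite expR_ge0 -[X in _ <= X]expR0 ler_expR oppr_le0 => /(_ x0).
  rewrite /q expR_gt0 expRK opprK cE.
  have -> : phi^`()%classic x / expR (- x) - p.[expR (- x)] =
     (phi^`()%classic x - expR (- x) * p.[expR (- x)]) / expR (- x).
    by field; rewrite gt_eqF// expR_gt0.
  rewrite normrM normfV (gtr0_norm (expR_gt0 _)) ler_pdivrMr ?expR_gt0//.
exists n, c; split => //.
(* For s = 1 and s = -1, the function u below is nonincreasing by d1 and
   tends to 0 at infinity, hence it is nonnegative. *)
have sgn (s : R) : s ^+ 2 = 1 -> forall x, 0 <= x ->
    0 <= eps * expR (- x) + s * (phi x - exp_sum n c x).
  move=> s1 x x0.
  pose u y := eps * expR (-1 * y) + s * (phi y - exp_sum n c y).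
  have du (y : R) : is_derive y 1 u (- eps * expR (- y) +
      s * (phi^`()%classic y + exp_sum n (fun i => i.+1%:R * c i) y)).
    have dphi : is_derive y 1 phi (phi^`()%classic y).
      by rewrite derive1E; apply: derivableP; exact: test_function_derivable.
    apply: is_derive_eq (is_deriveD (is_deriveZ eps (is_derive_expM (-1) y))
      (is_deriveZ s (is_deriveB dphi (is_derive_exp_sum n c y)))) _.
    by rewrite /GRing.scale /= !mulN1r; ring.
  have u0 : u y @[y --> +oo] --> 0.
    rewrite -[X in _ --> X]addr0; apply: cvgD.
      rewrite -[X in _ --> X](mulr0 eps); apply: cvgMl_tmp.
      under eq_fun do rewrite mulN1r; exact: cvgr_expR.
    rewrite -[X in _ --> X](mulr0 s); apply: cvgMl_tmp.
    rewrite -[X in _ --> X](subr0 0); apply: cvgB; last exact: exp_sum_cvg0.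
    apply: cvg_near_cst; near=> y; have [|//] := BP y.
    by near: y; apply: nbhs_pinfty_gt; exact: num_real.
  have s_norm : `|s| = 1.
    by apply/eqP; rewrite -(@pexpr_eq1 _ _ 2)// real_normK ?num_real// s1.
  have cu : continuous u.
    move=> z; apply: differentiable_continuous; apply/derivable1_diffP.
    by have [] := du z.
  have -> : eps * expR (- x) + s * (phi x - exp_sum n c x) = u x.
    by rewrite /u mulN1r.
  apply: (cvgr_to_le u0); near=> y.
  apply: (@ler0_derive1_nincry _ u 0) => //.
  - move=> z; rewrite in_itv /= andbT => z0.
    have [_ dE] := du z; rewrite derive1E dE mulNr addrC subr_le0.
    rewrite (le_trans (ler_norm _))// normrM s_norm mul1r d1// ltW//.
  - exact: continuous_subspaceT cu.
move=> x x0; rewrite ler_norml; apply/andP; split.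
  by have := sgn 1 (expr1n _ _) x x0; rewrite mul1r; lra.
by have := sgn (-1) (sqrr_sign _ 1) x x0; rewrite mulN1r; lra.
Unshelve. all: by end_near. Qed.

End ExponentialApproximation.

(** * Weak derivatives from Laplace transforms *)

Section LaplaceDetermines.
Context {R : realType}.
Local Notation hl := (@half_line R).

(** The class on which the Laplace transform is taken at all l >= 1. Vanishing on
    the negative axis lets pointwise bounds on the half-line hold everywhere. *)
Definition exp_integrable (f : R -> R) := [/\ measurable_fun setT f,
  forall x, x < 0 -> f x = 0 &
  (\int[hl]_x (expR (- x) * `|f x|)%:E < +oo)%E].

Lemma measurable_exp_sum n (c : nat -> R) : measurable_fun setT (exp_sum n c).
Proof.
apply: continuous_measurable_fun => x; apply: differentiable_continuous.
by apply/derivable1_diffP; have [] := is_derive_exp_sum n c x.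
Qed.

Lemma measurable_expRN : measurable_fun setT (fun x : R => expR (- x)).
Proof. by apply: measurableT_comp => //; exact: oppr_measurable. Qed.

Section Weighted.
Variable f : R -> R.
Hypothesis fexp : exp_integrable f.

Lemma exp_integrableE : hl.-integrable setT (EFin \o (fun x => expR (- x) * f x)).
Proof.
have [mf f0 ffin] := fexp; apply/integrableP; split.
  by apply/measurable_EFinP/measurable_funM => //; exact: measurable_expRN.
under eq_integral do rewrite /= normrM ger0_norm ?expR_ge0//.
exact: ffin.
Qed.

Lemma weighted_integrable (psi : R -> R) C : measurable_fun setT psi ->
  (forall x, 0 <= x -> `|psi x| <= C * expR (- x)) ->
  hl.-integrable setT (EFin \o (fun x => psi x * f x)).
Proof.
have [mf f0 ffin] := fexp => mpsi psiC.
apply: (@le_integrable _ (measurableTypeR R) R hl setT measurableT _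
  (fun x => C%:E * (expR (- x) * f x)%:E)%E) => //.
- by apply/measurable_EFinP/measurable_funM.
- move=> x _ /=; rewrite lee_fin !normrM.
  have [x0|/f0->] := leP 0 x; last by rewrite normr0 !mulr0.
  rewrite mulrA ler_wpM2r// (le_trans (psiC _ x0))//.
  by rewrite (ger0_norm (expR_ge0 _)) ler_wpM2r ?expR_ge0// ler_norm.
- by apply: integrableZl => //; exact: exp_integrableE.
Qed.

Lemma weighted_integral_le (psi : R -> R) C : measurable_fun setT psi ->
  (forall x, 0 <= x -> `|psi x| <= C * expR (- x)) ->
  `|\int[hl]_x (psi x * f x)| <= C * \int[hl]_x (expR (- x) * `|f x|).
Proof.
have [mf f0 ffin] := fexp => mpsi psiC.
have ie : hl.-integrable setT (EFin \o (fun x => expR (- x) * `|f x|)).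
  apply: eq_integrable (integrable_norm exp_integrableE) => // x _ /=.
  by rewrite normrM ger0_norm ?expR_ge0.
rewrite -RintegralZl//.
apply: (le_trans (le_normr_Rintegral _ _)) => //.
  exact: weighted_integrable psiC.
apply: le_Rintegral => //.
- exact/integrable_norm/(weighted_integrable mpsi psiC).
- rewrite (_ : EFin \o _ = fun x => (C%:E * (expR (- x) * `|f x|)%:E)%E)//.
  exact: integrableZl.
move=> x _; rewrite normrM.
have [x0|/f0->] := leP 0 x; last by rewrite normr0 !mulr0.
by rewrite mulrA ler_wpM2r// psiC.
Qed.

Lemma exp_sum_bound n (c : nat -> R) : exists C, forall x, 0 <= x ->
  `|exp_sum n c x| <= C * expR (- x).
Proof.
exists (\sum_(i < n) `|c i|) => x x0; rewrite mulr_suml.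
apply: (le_trans (ler_norm_sum _ _ _)); apply: ler_sum => i _.
rewrite normrM (ger0_norm (expR_ge0 _)) ler_wpM2l// ler_expR mulNr lerN2.
by rewrite ler_peMl// ler1n.
Qed.

Lemma integral_exp_sum n (c : nat -> R) : \int[hl]_x (exp_sum n c x * f x) =
  \sum_(i < n) c i * \int[hl]_x (expR (- i.+1%:R * x) * f x).
Proof.
elim: n => [|n ih].
  rewrite big_ord0 exp_sum0 /Rintegral integral0_eq// => x _.
  by rewrite mul0r.
rewrite big_ord_recr -ih exp_sumS.
have intn : hl.-integrable setT (EFin \o (fun x => expR (- n.+1%:R * x) * f x)).
  apply: (@weighted_integrable _ 1).
    by apply: measurableT_comp => //; exact: mulrl_measurable.
  move=> x x0; rewrite mul1r ger0_norm ?expR_ge0// ler_expR mulNr lerN2.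
  by rewrite ler_peMl// ler1n.
rewrite /= -RintegralZl// -RintegralD//.
- by congr fine; apply: eq_integral => x _; congr EFin; rewrite /=; ring.
- have [C CP] := exp_sum_bound n c.
  exact: weighted_integrable (measurable_exp_sum n c) CP.
- rewrite (_ : EFin \o _ = fun x => ((c n)%:E * (expR (- n.+1%:R * x) * f x)%:E)%E)//.
  exact: integrableZl.
Qed.

End Weighted.

(** The hypothesis is the conclusion for phi = exp (- (n + 1) x). It extends to
    sums of such exponentials by linearity and to test functions by
    exp_sum_approx, whose weight exp (- x) is integrable against f and b. *)
Lemma laplace_weak_derivative (f b phi : R -> R) :
  exp_integrable f -> exp_integrable b ->
  (forall n, n.+1%:R * \int[hl]_x (expR (- n.+1%:R * x) * f x) =
    - \int[hl]_x (expR (- n.+1%:R * x) * b x)) ->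
  test_function phi ->
  \int[hl]_x (phi^`()%classic x * f x) = \int[hl]_x (phi x * b x).
Proof.
move=> fe be fb tphi; apply/eqP; rewrite -subr_eq0 -normr_le0; apply/eqP.
pose K := \int[hl]_x (expR (- x) * `|f x|) + \int[hl]_x (expR (- x) * `|b x|).
have K0 : 0 <= K.
  by rewrite addr_ge0// Rintegral_ge0// => x _; rewrite mulr_ge0 ?expR_ge0.
have mphi : measurable_fun setT phi.
  by apply: continuous_measurable_fun; exact: continuous_test_function.
have mphi' : measurable_fun setT phi^`()%classic.
  by apply: continuous_measurable_fun; exact: continuous_derive1_test_function.
apply/eqP; apply/ler_addgt0Pr => eps eps0; rewrite add0r.
have K1 : 0 < K + 1 by rewrite ltr_wpDl.
have [n [c [d1 d0]]] := exp_sum_approx tphi (divr_gt0 eps0 K1).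
set e := eps / (K + 1) in d1 d0.
pose c' i := i.+1%:R * c i.
have mD1 : measurable_fun setT (fun x => phi^`()%classic x + exp_sum n c' x).
  by apply: measurable_funD => //; exact: measurable_exp_sum.
have mD0 : measurable_fun setT (fun x => phi x - exp_sum n c x).
  by apply: measurable_funB => //; exact: measurable_exp_sum.
have [C CP] := exp_sum_bound n c; have [C' CP'] := exp_sum_bound n c'.
have -> : \int[hl]_x (phi^`()%classic x * f x) =
    \int[hl]_x ((phi^`()%classic x + exp_sum n c' x) * f x) -
    \int[hl]_x (exp_sum n c' x * f x).
  rewrite -RintegralB//.
  - by congr fine; apply: eq_integral => x _; congr EFin; rewrite /=; ring.
  - exact: weighted_integrable mD1 d1.
  - exact: weighted_integrable (measurable_exp_sum n c') CP'.
have -> : \int[hl]_x (phi x * b x) =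
    \int[hl]_x ((phi x - exp_sum n c x) * b x) +
    \int[hl]_x (exp_sum n c x * b x).
  rewrite -RintegralD//.
  - by congr fine; apply: eq_integral => x _; congr EFin; rewrite /=; ring.
  - exact: weighted_integrable mD0 d0.
  - exact: weighted_integrable (measurable_exp_sum n c) CP.
have -> : \int[hl]_x (exp_sum n c' x * f x) = - \int[hl]_x (exp_sum n c x * b x).
  rewrite !integral_exp_sum// -sumrN; apply: eq_bigr => i _.
  by rewrite /c' mulrC mulrA [_ * i.+1%:R]mulrC fb mulNr mulrC.
rewrite opprK opprD addrACA addrC subrr add0r.
apply: (le_trans (ler_normB _ _)).
apply: (@le_trans _ _ (e * K)); last first.
  by rewrite /e mulrAC ler_pdivrMr// ler_wpM2l ?(ltW eps0)// lerDl.
rewrite /K mulrDr lerD//.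
- exact: weighted_integral_le mD1 d1.
- exact: weighted_integral_le mD0 d0.
Qed.

End LaplaceDetermines.

(** * Laplace transforms of causal functions *)

Section CausalFunctions.
Context {R : realType} {H : completeNormedModType R}.
Variable ip : inner_product H.
Hypothesis H_separable : separable_space H.
Local Notation hl := (@half_line R).
Implicit Types (u g : R -> H).

(** The vector-valued counterpart of exp_integrable. *)
Definition exp_bochner g := [/\ weakly_measurable ip g,
  forall x, x < 0 -> g x = 0 &
  (\int[hl]_x (expR (- x) * `|g x|)%:E < +oo)%E].

Definition laplace (l : R) (f : R -> R) : R := \int[hl]_x (expR (- l * x) * f x).

Lemma measurable_expRM (l : R) : measurable_fun setT (fun x : R => expR (- l * x)).
Proof. by apply: measurableT_comp => //; exact: mulrl_measurable. Qed.

Lemma exp_integrable_ip g h : exp_bochner g -> exp_integrable (fun x => ip h (g x)).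
Proof.
move=> [mg g0 gfin]; split; [exact: mg|by move=> x /g0 ->; rewrite ip0|].
have mn := measurable_normr H_separable mg.
have me : measurable_fun setT (fun x : R => (expR (- x) * `|g x|)%:E).
  by apply/measurable_EFinP/measurable_funM => //; exact: measurable_expRN.
apply: (@le_lt_trans _ _ (\int[hl]_x (`|h|%:E * (expR (- x) * `|g x|)%:E))%E).
  apply: ge0_le_integral => //.
  - apply/measurable_EFinP/measurable_funM; first exact: measurable_expRN.
    by apply: measurableT_comp => //; exact: mg.
  - exact: measurable_funeM.
  - move=> x _; rewrite -EFinM lee_fin mulrCA ler_wpM2l ?expR_ge0//.
    exact: cauchy_schwarz.
have e0 x : setT x -> (0 <= (expR (- x) * `|g x|)%:E)%E.
  by move=> _; rewrite lee_fin mulr_ge0// expR_ge0.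
by rewrite ge0_integralZl// lte_mul_pinfty.
Qed.

Lemma exp_integrable_norm g : exp_bochner g -> exp_integrable (fun x => `|g x|).
Proof.
move=> [mg g0 gfin]; split; first exact: (measurable_normr H_separable mg).
  by move=> x /g0 ->; rewrite normr0.
by under eq_integral do rewrite normr_id.
Qed.

Lemma laplace_integrable l f : 1 <= l -> exp_integrable f ->
  hl.-integrable setT (fun x => (expR (- l * x) * f x)%:E).
Proof.
move=> l1 fe; apply: (weighted_integrable fe (C := 1)).
  exact: measurable_expRM.
move=> x x0; rewrite mul1r ger0_norm ?expR_ge0// ler_expR mulNr lerN2.
exact: ler_peMl.
Qed.

Lemma laplaceE l f : 1 <= l -> exp_integrable f ->
  (laplace l f)%:E = (\int[hl]_x (expR (- l * x) * f x)%:E)%E.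
Proof.
move=> l1 fe; rewrite /laplace /Rintegral fineK//.
by apply: integrable_fin_num => //; exact: laplace_integrable.
Qed.

Lemma exp_integrableZ (c : R) (f : R -> R) : exp_integrable f -> exp_integrable (fun x => c * f x).
Proof.
move=> [mf f0 ffin]; split; first exact: measurable_funM.
  by move=> x /f0 ->; rewrite mulr0.
under eq_integral do rewrite normrM mulrCA EFinM.
have mE : measurable_fun setT (fun x : R => (expR (- x) * `|f x|)%:E).
  apply/measurable_EFinP/measurable_funM; first exact: measurable_expRN.
  exact: measurableT_comp.
have E0 x : setT x -> (0 <= (expR (- x) * `|f x|)%:E)%E.
  by move=> _; rewrite lee_fin mulr_ge0// expR_ge0.
by rewrite ge0_integralZl// lte_mul_pinfty.
Qed.

Lemma laplaceZ (l c : R) (f : R -> R) : 1 <= l -> exp_integrable f ->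
  laplace l (fun x => c * f x) = c * laplace l f.
Proof.
move=> l1 fe; rewrite /laplace -RintegralZl//; last exact: laplace_integrable.
by congr fine; apply: eq_integral => x _; rewrite mulrCA.
Qed.

Lemma weighted_bochner g (psi : R -> R) C : exp_bochner g -> measurable_fun setT psi ->
  (forall x, 0 <= x -> `|psi x| <= C * expR (- x)) ->
  weakly_measurable ip (fun x => psi x *: g x) /\
  (\int[hl]_x `|psi x *: g x|%:E < +oo)%E.
Proof.
move=> ge mpsi psiC; have [mg _ _] := ge.
split; first exact: weakly_measurableZ.
have /integrableP[_] := weighted_integrable (exp_integrable_norm ge) mpsi psiC.
apply: le_lt_trans; apply: ge0_ae_le_integralT => //.
by apply: aeW => x /=; rewrite lee_fin normrZ normrM normr_id.
Qed.

(** Shifting by s multiplies the Laplace transform by exp (- l s). *)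
Lemma exp_shift l f s : 1 <= l -> exp_integrable f -> 0 <= s ->
  (\int[hl]_r (expR (- l * r) * f (r - s))%:E =
   (expR (- l * s) * laplace l f)%:E)%E.
Proof.
move=> l1 fe s0; have [mf f0 _] := fe.
pose F (r : R) := (expR (- l * r) * f r)%:E.
have -> : (\int[hl]_r (expR (- l * r) * f (r - s))%:E =
    \int[hl]_r ((expR (- l * s))%:E * F (r - s)%R))%E.
  apply: eq_integral => r _; rewrite /F -EFinM mulrA -expRD.
  by congr (expR _ * _)%:E; ring.
have mF : measurable_fun setT F.
  by apply/measurable_EFinP/measurable_funM => //; exact: measurable_expRM.
have F0 x : x < 0 -> F x = 0%E by move=> /f0; rewrite /F => ->; rewrite mulr0.
rewrite (half_line_shift (f := fun r => ((expR (- l * s))%:E * F r)%E) _ _ s0).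
- by rewrite integralZl// ?laplace_integrable// EFinM laplaceE.
- exact: measurable_funeM.
- by move=> x /F0 ->; rewrite mule0.
Qed.

Lemma half_line_strongly_measurable_repr u : strongly_measurable hl u ->
  exists v : R -> H, [/\ weakly_measurable ip v, forall x, x < 0 -> v x = 0 &
    {ae hl, forall x, u x = v x}].
Proof.
move=> /(strongly_measurable_repr ip)[v mv uv].
exists (fun x => (\1_`[0, +oo[ x : R) *: v x); split.
- have mi : measurable_fun setT (\1_`[(0 : R), +oo[ : R -> R).
    by apply: measurable_indic; exact: measurable_itv.
  exact: weakly_measurableZ mi mv.
- move=> x x0; rewrite indicE mem_setE in_itv /= andbT leNgt x0.
  by rewrite scale0r.
- apply: filterS2 ae_half_line_ge0 uv => x x0 ->.
  by rewrite indicE mem_setE in_itv /= andbT x0 scale1r.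
Qed.

Lemma LE_norm_ae d (T : measurableType d) (mu : {measure set T -> \bar R}) (p : R)
    (f g : T -> H) :
  {ae mu, forall x, f x = g x} -> LE_norm mu p f = LE_norm mu p g.
Proof.
move=> fg; rewrite /LE_norm unlock; congr (_ `^ _)%E.
apply: ge0_ae_eq_integralT => [x|x|]; rewrite ?poweR_ge0//.
by apply: filterS fg => x ->.
Qed.

(** The exponential is square integrable, so convergence in L^2 entails
    convergence of Laplace transforms. *)
Lemma hoelder_exp l : 0 < l -> exists2 C : R, 0 <= C &
  forall g, weakly_measurable ip g ->
  (\int[hl]_x (expR (- l * x) * `|g x|)%:E <= C%:E * LE_norm hl 2 g)%E.
Proof.
move=> l0; pose C := Lnorm hl 2%:E (fun x : R => (expR (- l * x))%:E).
have Cfin : (C < +oo)%E.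
  rewrite /C unlock; apply: poweR_lty.
  under eq_integral => x _.
    rewrite abse_EFin ger0_norm ?expR_ge0// poweR_EFin -expRM.
    over.
  apply: (@le_lt_trans _ _ ((2 * l)^-1)%:E); last exact: ltry.
  rewrite -half_line_exp ?mulr_gt0//.
  rewrite le_eqVlt; apply/orP; left; apply/eqP; apply: eq_integral => x _.
  by congr (expR _)%:E; ring.
exists (fine C) => [|g mg]; first by rewrite fine_ge0// Lnorm_ge0.
rewrite fineK ?ge0_fin_numE ?Lnorm_ge0//.
have two : 2^-1 + 2^-1 = 1 :> R by field.
have := hoelder hl (measurable_expRM l) (measurable_normr H_separable mg)
  (ltr0n _ 2) (ltr0n _ 2) two.
rewrite Lnorm1; apply: le_trans.
rewrite le_eqVlt; apply/orP; left; apply/eqP; apply: eq_integral => x _.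
by rewrite /= normrM normr_id ger0_norm// expR_ge0.
Qed.

Lemma exp_bochner_repr u : LE hl 2 u -> exists v,
  exp_bochner v /\ {ae hl, forall x, u x = v x}.
Proof.
move=> [/half_line_strongly_measurable_repr[v [mv v0 uv]] ufin].
exists v; split => //; split => //.
have [C C0 CP] := hoelder_exp (@ltr01 R).
under eq_integral do rewrite -mulN1r.
apply: (le_lt_trans (CP v mv)); rewrite -(LE_norm_ae 2 uv).
by rewrite lte_mul_pinfty ?lee_fin// fin_numE.
Qed.

End CausalFunctions.

(** * The causal convolution *)

Section Convolutions.
Context {R : realType} {H : completeNormedModType R}.
Variable ip : inner_product H.
Hypothesis H_separable : separable_space H.
Local Notation hl := (@half_line R).
Implicit Types (u v g : R -> H).

Variable k : R -> R.
Hypothesis k_adm : admissible_kernel k.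
Variable M : {measure set (measurableTypeR R) -> \bar R}.
Hypothesis M_tail : tail_measure k M.
Local Notation ck := (causal_kernel k).

Lemma exp_integrable_kernel : exp_integrable ck.
Proof.
split; first exact: measurable_causal_kernel.
  by move=> x x0; rewrite /causal_kernel ltNge (ltW x0).
under eq_integral do rewrite ger0_norm ?causal_kernel_ge0// -mulN1r.
exact: kernel_laplace_fin.
Qed.

Lemma laplace_kernel l : 1 <= l -> l * laplace l ck = laplace_exponent M l.
Proof.
move=> l1; have l0 : 0 < l by exact: lt_le_trans l1.
apply: EFin_inj; rewrite (laplace_exponent_kernel k_adm M_tail l0).
have ke := exp_integrable_kernel.
rewrite EFinM laplaceE// -integralZl//; last exact: laplace_integrable.
Qed.

(** The causal convolution is only defined for almost every t; g is a good
    representative, whose transform is a product by Fubini's theorem. *)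
Lemma causal_conv_repr u v : exp_bochner ip v ->
  {ae hl, forall x, u x = v x} -> exists g,
  [/\ exp_bochner ip g, {ae hl, forall t, causal_conv k u t = g t} &
    forall l h, 1 <= l -> laplace l (fun t => ip h (g t)) =
      laplace l ck * laplace l (fun t => ip h (v t))].
Proof.
move=> ve uv; have [mv v0 vfin] := ve.
have ke := exp_integrable_kernel; have [mk k0 kfin] := ke.
pose G (z : R * R) : H := ck (z.1 - z.2) *: v z.2.
have mG : weakly_measurable ip G.
  apply: weakly_measurableZ.
    by apply: (measurableT_comp mk); exact: measurable_funB.
  exact: weakly_measurable_comp measurable_snd mv.
have s := @half_line_sigma_finite R.
have mGn := measurable_normr H_separable mG.
have fubi (f : R * R -> R) : measurable_fun setT f -> (forall z, 0 <= f z) ->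
  (\int[hl]_x \int[hl]_y (f (x, y))%:E = \int[hl]_y \int[hl]_x (f (x, y))%:E)%E.
  move=> mf f0; apply: (tonelli_sigma_finite s s (f := EFin \o f)) => //.
  exact/measurable_EFinP.
(* Transform in t of the kernel shifted by y; for y < 0 both sides vanish
   because the factor c does. *)
have inner l (y c : R) : 1 <= l -> (y < 0 -> c = 0) ->
    (\int[hl]_x (expR (- l * x) * (ck (x - y) * c))%:E =
     (laplace l ck * (expR (- l * y) * c))%:E)%E.
  move=> l1 yc; have [y0|/yc ->] := leP 0 y; last first.
    by rewrite !mulr0 integral0_eq// => x _; rewrite !mulr0.
  under eq_integral do rewrite [ck _ * c]mulrC.
  rewrite (exp_shift l1 (exp_integrableZ c ke) y0) laplaceZ//.
  by rewrite mulrC -mulrA mulrCA [c * _]mulrC.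
have [] := @bochner_fubini R H ip H_separable _ _ _ _ hl hl s s
  (fun t s => (\1_`[0, t] s * k (t - s)) *: u s) G (fun x => expR (- x)).
- exact: mG.
- apply: aeW => t; apply: filterS3 ae_half_line_ge0 (ae_half_line_neq t) uv.
  move=> y y0 yt ->; rewrite /G /causal_kernel /= subr_gt0 indicE mem_setE.
  rewrite in_itv /= y0 /=; case: ltgtP yt => //= _ _; rewrite ?mul1r ?mul0r//.
- exact: measurable_expRN.
- by move=> x; exact: expR_gt0.
- rewrite (fubi (fun z => expR (- z.1) * `|G z|))//; last first.
    apply: measurable_funM => //.
    exact: measurableT_comp measurable_expRN measurable_fst.
  under eq_integral => y _.
    under eq_integral => x _.
      rewrite /G /= normrZ ger0_norm ?causal_kernel_ge0// -[- x]mulN1r.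
      over.
    rewrite (inner 1%R)//; last by move=> /v0 ->; rewrite normr0.
    rewrite EFinM mulN1r.
    over.
  have lk0 : 0 <= laplace 1 ck.
    by apply: Rintegral_ge0 => y _; rewrite mulr_ge0 ?expR_ge0 ?causal_kernel_ge0.
  have mev : measurable_fun setT (fun y : R => (expR (- y) * `|v y|)%:E).
    apply/measurable_EFinP/measurable_funM; first exact: measurable_expRN.
    exact: (measurable_normr H_separable mv).
  have ev0 y : setT y -> (0 <= (expR (- y) * `|v y|)%:E)%E.
    by move=> _; rewrite lee_fin mulr_ge0 ?expR_ge0.
  by rewrite ge0_integralZl ?lte_mul_pinfty.
move=> g [mg gG gle gfin gF]; exists g.
have g0 x : x < 0 -> g x = 0.
  move=> x0; apply/normr0_eq0/le_anti; rewrite normr_ge0 andbT -lee_fin.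
  apply: (le_trans (gle x)); rewrite integral0_eq// => y _.
  rewrite /G /=; have [y0|/v0 ->] := leP 0 y; last by rewrite scaler0 normr0.
  rewrite k0 ?scale0r ?normr0// subr_lt0; exact: lt_le_trans y0.
split => // l h l1.
have ge : exp_bochner ip g by [].
have vh := exp_integrable_ip H_separable h ve.
apply: EFin_inj; rewrite laplaceE//; last exact: exp_integrable_ip.
rewrite (gF h (fun x => expR (- l * x))); last 2 first.
- exact: measurable_expRM.
- apply: filterS ae_half_line_ge0 => x x0.
  by rewrite ger0_norm ?expR_ge0// ler_expR mulNr lerN2 ler_peMl.
under eq_integral => y _.
  under eq_integral => x _.
    rewrite /G /= ipZ.
    over.
  rewrite inner//; last by move=> /v0 ->; rewrite ip0.
  rewrite EFinM.
  over.
by rewrite integralZl ?laplace_integrable// -laplaceE.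
Qed.

End Convolutions.

(** * The convolution semigroup *)

Section ShiftSemigroup.
Context {R : realType} {H : completeNormedModType R}.
Variable ip : inner_product H.
Hypothesis H_separable : separable_space H.
Local Notation hl := (@half_line R).
Implicit Types (u v g : R -> H).

Variable M : {measure set (measurableTypeR R) -> \bar R}.
Variable mu : R -> probability (measurableTypeR R) R.
Hypothesis mu_semigroup : convolution_semigroup M mu.
Variable t : R.
Hypothesis t_ge0 : 0 <= t.

Local Notation pos := (\1_`[(0 : R), +oo[ : R -> R).

Lemma pos_exp_le1 (l s : R) : 0 <= l -> `|pos s * expR (- l * s)| <= 1.
Proof.
move=> l0; rewrite indicE mem_setE in_itv /= andbT.
have [s0|s0] := leP 0 s; last by rewrite mul0r normr0.
rewrite mul1r ger0_norm ?expR_ge0// -expR0 ler_expR mulNr oppr_le0.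
exact: mulr_ge0.
Qed.

Lemma measurable_pos : measurable_fun setT pos.
Proof. by apply: measurable_indic; exact: measurable_itv. Qed.

Lemma pos_exp_integrable (l : R) : 0 <= l ->
  (mu t).-integrable setT (fun s => (pos s * expR (- l * s))%:E).
Proof.
move=> l0; have := @finite_measure_integrable_cst _ _ _ (mu t) setT 1 measurableT.
apply: le_integrable => //.
  apply/measurable_EFinP/measurable_funM; first exact: measurable_pos.
  exact: measurable_expRM.
by move=> s _ /=; rewrite lee_fin normr1 pos_exp_le1.
Qed.

Lemma pos_exp_integral (l : R) : 0 < l ->
  (\int[mu t]_s (pos s * expR (- l * s))%:E =
   (expR (- t * laplace_exponent M l))%:E)%E.
Proof.
move=> l0; have [_ /(_ l l0) <-] := mu_semigroup t_ge0.
rewrite Rintegral_mkcond /Rintegral fineK; last first.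
  apply: integrable_fin_num => //.
  apply: eq_integrable (pos_exp_integrable (ltW l0)) => // s _.
  by rewrite patchE indicE; case: ifP => _; rewrite ?mul1r ?mul0r.
apply: eq_integral => s _.
by rewrite patchE indicE; case: ifP => _; rewrite ?mul1r ?mul0r.
Qed.

Lemma ae_mu_ge0 : {ae mu t, forall s : R, 0 <= s}.
Proof.
have [mu0 _] := mu_semigroup t_ge0.
exists `]-oo, 0[%classic; split => //.
by move=> x /= /negP; rewrite in_itv /= -ltNge.
Qed.

Lemma exp_shift_pos (l s : R) f : 1 <= l -> exp_integrable f ->
  (\int[hl]_r (expR (- l * r) * (pos s * f (r - s)))%:E =
   (pos s * expR (- l * s))%:E * (laplace l f)%:E)%E.
Proof.
move=> l1 fe; rewrite indicE mem_setE in_itv /= andbT.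
have [s0|s0] := leP 0 s; last first.
  by rewrite !mul0r mul0e integral0_eq// => r _; rewrite mul0r mulr0.
rewrite mul1r -EFinM -exp_shift//.
by apply: eq_integral => r _; rewrite mul1r.
Qed.

(** If u and v agree off a null set N, then their shifts by s agree at r unless
    r - s lies in N, and by Tonelli this happens for mu_t-almost no s, for
    almost every r. Here mu_t may be singular, so it cannot be said for every
    r. *)
Lemma half_line_null_shift (N : set R) : measurable N -> hl N = 0%E ->
  {ae hl, forall r : R, {ae mu t, forall s : R,
    0 <= s -> 0 <= r - s -> ~ N (r - s)}}.
Proof.
move=> mN N0; pose N' := N `&` `[(0 : R), +oo[%classic.
have mN' : measurable N' by apply: measurableI => //; exact: measurable_itv.
have N'0 : hl N' = 0%E.
  apply/eqP; rewrite -measure_le0 -N0; apply: le_measure; rewrite ?inE//.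
  by move=> x [].
pose f (z : R * R) : \bar R := (pos z.2 * \1_N' (z.1 - z.2))%:E.
have mf : measurable_fun setT f.
  apply/measurable_EFinP/measurable_funM.
    exact: measurableT_comp measurable_pos measurable_snd.
  apply: (measurableT_comp (f := \1_N' : R -> R)); first exact: measurable_indic.
  exact: measurable_funB.
have f0 z : (0 <= f z)%E by rewrite lee_fin mulr_ge0// indicE.
have smu : sigma_finite setT (mu t) by exact: sigma_finiteT.
have := tonelli_sigma_finite half_line_sigma_finite smu mf f0.
rewrite [in X in _ = X]integral0_eq => [int0|s _]; last first.
  rewrite /f /= indicE mem_setE in_itv /= andbT.
  have [s0|s0] := leP 0 s; last by rewrite integral0_eq// => r _; rewrite mul0r.
  under eq_integral do rewrite mul1r.
  rewrite (half_line_shift (f := fun r => (\1_N' r : R)%:E))//.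
  - by rewrite integral_indic// setIT N'0.
  - by apply/measurable_EFinP; exact: measurable_indic.
  - move=> x x0; rewrite indicE memNset// => -[_] /=.
    by rewrite in_itv /= andbT leNgt x0.
have mI := measurable_integral2 smu mf f0.
have : {ae hl, forall r : R, (\int[mu t]_s f (r, s) = 0)%E}.
  have [+ _] := ae_eq_integral_abs hl measurableT mI.
  have -> : (\int[hl]_x `|\int[mu t]_y f (x, y)| = 0)%E.
    rewrite -int0; apply: eq_integral => x _.
    by rewrite gee0_abs// integral_ge0.
  by move=> /(_ erefl); apply: filterS => r /(_ I).
apply: filterS => r r0.
have mfr : measurable_fun setT (fun s => f (r, s)).
  exact: (measurableT_comp mf (pair1_measurable r)).
have [+ _] := ae_eq_integral_abs (mu t) measurableT mfr.
have -> : (\int[mu t]_x `|f (r, x)| = 0)%E.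
  by rewrite -r0; apply: eq_integral => x _; rewrite gee0_abs.
move=> /(_ erefl); apply: filterS => s /(_ I) + s0 rs0 Nrs.
have N'rs : N' (r - s) by split => //=; rewrite in_itv /= rs0.
rewrite /f /= !indicE (mem_set N'rs) mem_setE in_itv /= s0 mulr1 => -[].
by move/eqP; rewrite oner_eq0.
Qed.

(** Averaging exp_shift over mu_t: the transform of U_t u is that of u times
    the transform of mu_t. *)
Lemma Ut_repr u v : exp_bochner ip v -> {ae hl, forall x, u x = v x} ->
  exists g, [/\ exp_bochner ip g, {ae hl, forall r, Ut mu t u r = g r} &
    forall l h, 1 <= l -> laplace l (fun r => ip h (g r)) =
      expR (- t * laplace_exponent M l) * laplace l (fun r => ip h (v r))].
Proof.
move=> ve uv; have [mv v0 vfin] := ve.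
pose G (z : R * R) : H := pos z.2 *: v (z.1 - z.2).
have msub : measurable_fun setT (fun z : R * R => z.1 - z.2).
  exact: measurable_funB.
have mG : weakly_measurable ip G.
  apply: weakly_measurableZ.
    exact: measurableT_comp measurable_pos measurable_snd.
  exact: weakly_measurable_comp msub mv.
have shl := @half_line_sigma_finite R.
have smu : sigma_finite setT (mu t) by exact: sigma_finiteT.
have mGn := measurable_normr H_separable mG.
have vne := exp_integrable_norm H_separable ve.
have posn s : `|pos s| = pos s by rewrite ger0_norm// indicE.
have [] := @bochner_fubini R H ip H_separable _ _ _ _ hl (mu t) shl smu
  (fun r s => time_shift s u r) G (fun x => expR (- x)).
- exact: mG.
- have [N [mN N0 subN]] := uv.
  apply: filterS (half_line_null_shift mN N0) => r.
  have FF : Filter (nbhs (almost_everywhere (mu t))).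
    exact: ae_filter_ringOfSetsType.
  apply: filterS2 ae_mu_ge0 => s s0 rsN.
  rewrite /time_shift /G /= indicE mem_setE in_itv /= s0 /= scale1r.
  have [rs0|/v0 ->//] := leP 0 (r - s).
  by apply: contrapT => uvrs; apply: (rsN s0 rs0); exact: subN.
- exact: measurable_expRN.
- by move=> x; exact: expR_gt0.
- rewrite (tonelli_sigma_finite shl smu
    (f := fun z => (expR (- z.1) * `|G z|)%:E)); last 2 first.
  + apply/measurable_EFinP/measurable_funM => //.
    exact: measurableT_comp measurable_expRN measurable_fst.
  + by move=> z; rewrite lee_fin mulr_ge0// expR_ge0.
  under eq_integral => s _.
    under eq_integral => r _.
      rewrite /G /= normrZ posn -[- r]mulN1r.
      over.
    rewrite (exp_shift_pos s (lexx 1) vne).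
    over.
  rewrite integralZr//; last exact: pos_exp_integrable.
  by rewrite pos_exp_integral// -EFinM ltry.
move=> g [mg gG gle gfin gF]; exists g.
have g0 x : x < 0 -> g x = 0.
  move=> x0; apply/normr0_eq0/le_anti; rewrite normr_ge0 andbT -lee_fin.
  apply: (le_trans (gle x)); rewrite integral0_eq// => s _.
  rewrite /G /= indicE mem_setE in_itv /= andbT.
  have [s0|_] := leP 0 s; last by rewrite scale0r normr0.
  by rewrite v0 ?scaler0 ?normr0// subr_lt0; exact: lt_le_trans s0.
split => // l h l1.
have ge : exp_bochner ip g by [].
have l0 : 0 < l by exact: lt_le_trans l1.
have vh := exp_integrable_ip H_separable h ve.
apply: EFin_inj; rewrite laplaceE//; last exact: exp_integrable_ip.
rewrite (gF h (fun x => expR (- l * x))); last 2 first.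
- exact: measurable_expRM.
- apply: filterS ae_half_line_ge0 => x x0.
  by rewrite ger0_norm ?expR_ge0// ler_expR mulNr lerN2 ler_peMl.
under eq_integral => s _.
  under eq_integral => x _.
    rewrite /G /= ipZ.
    over.
  rewrite (exp_shift_pos s l1 vh).
  over.
rewrite integralZr//; last exact/pos_exp_integrable/ltW.
by rewrite pos_exp_integral// -EFinM.
Qed.

End ShiftSemigroup.

(** * The generator *)

Section GeneratorLaplace.
Context {R : realType} {H : completeNormedModType R}.
Variable ip : inner_product H.
Hypothesis H_separable : separable_space H.
Local Notation hl := (@half_line R).
Implicit Types (u v g w : R -> H).

Variable M : {measure set (measurableTypeR R) -> \bar R}.
Variable mu : R -> probability (measurableTypeR R) R.
Hypothesis mu_semigroup : convolution_semigroup M mu.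

Lemma laplaceB (l : R) (f g : R -> R) : 1 <= l ->
  exp_integrable f -> exp_integrable g ->
  laplace l (fun x => f x - g x) = laplace l f - laplace l g.
Proof.
move=> l1 fe ge; rewrite /laplace -RintegralB//; [|exact: laplace_integrable..].
by congr fine; apply: eq_integral => x _; rewrite mulrBr.
Qed.

Lemma exp_integrableB (f g : R -> R) : exp_integrable f -> exp_integrable g ->
  exp_integrable (fun x => f x - g x).
Proof.
move=> fe ge; have [mf f0 _] := fe; have [mg g0 _] := ge; split.
- exact: measurable_funB.
- by move=> x x0; rewrite f0// g0// subr0.
have := integrableB measurableT (exp_integrableE fe) (exp_integrableE ge).
move=> /integrableP[_]; apply: le_lt_trans; apply: ge0_ae_le_integralT => //.
apply: aeW => x /=; rewrite lee_fin -mulrBr normrM.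
by rewrite (ger0_norm (expR_ge0 _)).
Qed.

(** The derivative of exp (- t c) at t = 0. *)
Lemma cvg_exp_slope (c : R) : t^-1 * (expR (- t * c) - 1) @[t --> 0^'+] --> - c.
Proof.
have [dex dE] := is_derive_expM (- c) (0 : R).
rewrite mulr0 expR0 mulr1 in dE.
have /cvg_dnbhs_at_right := dex; rewrite -/(derive _ _ _) dE.
apply: cvg_trans; apply: near_eq_cvg; apply: nearW => t /=.
rewrite mulr0 expR0 addr0 /GRing.scale /= mulr1; congr (_ * (expR _ - _)); ring.
Qed.

(** The transform of (U_t u - u) / t is (exp (- t psi) - 1) / t times that of u;
    as t tends to 0, the left-hand side converges because the difference
    quotient does so in L^2, and the right-hand side because of
    cvg_exp_slope. *)
Lemma generator_laplace u w v w' : Lambda_H mu u w ->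
  exp_bochner ip v -> {ae hl, forall x, u x = v x} ->
  exp_bochner ip w' -> {ae hl, forall x, w x = w' x} ->
  forall l h, 1 <= l -> laplace l (fun x => ip h (w' x)) =
    - laplace_exponent M l * laplace l (fun x => ip h (v x)).
Proof.
move=> [_ _ Dcvg] ve uv we ww l h l1.
have l0 : 0 < l by exact: lt_le_trans l1.
have [C C0 CP] := hoelder_exp ip H_separable l0.
have vh := exp_integrable_ip H_separable h ve.
have wh := exp_integrable_ip H_separable h we.
set A := laplace l (fun x => ip h (v x)); set B := laplace l _.
set psi := laplace_exponent M l.
pose N t := LE_norm hl 2 (fun r => t^-1 *: (Ut mu t u r - u r) - w r).
have bound t : 0 < t -> (N t < +oo)%E ->
    (`|t^-1 * (expR (- t * psi) - 1) * A - B|%:E <= (`|h| * C)%:E * N t)%E.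
  move=> t0 Nfin.
  have [g [ge gU gl]] := Ut_repr H_separable mu_semigroup (ltW t0) ve uv.
  have gh := exp_integrable_ip H_separable h ge.
  pose d r := t^-1 *: (g r - v r) - w' r.
  have NE : N t = LE_norm hl 2 d.
    apply: LE_norm_ae; apply: filterS3 gU uv ww => r.
    by rewrite /d => -> -> ->.
  have md : weakly_measurable ip d.
    apply: weakly_measurableB; last by have [] := we.
    apply: (weakly_measurableZ (a := fun=> t^-1)) => //.
    by apply: weakly_measurableB; [have [] := ge|have [] := ve].
  have dl : laplace l (fun r => ip h (d r)) =
      t^-1 * (expR (- t * psi) - 1) * A - B.
    have -> : (fun r => ip h (d r)) =
        (fun r => t^-1 * (ip h (g r) - ip h (v r)) - ip h (w' r)).
      by apply/funext => r; rewrite /d ipB ipZ ipB.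
    have gvh := exp_integrableB gh vh.
    rewrite laplaceB//; last exact: exp_integrableZ.
    by rewrite laplaceZ// laplaceB// gl// -/psi -/A -/B; ring.
  have dh : exp_integrable (fun r => ip h (d r)).
    have -> : (fun r => ip h (d r)) =
        (fun r => t^-1 * (ip h (g r) - ip h (v r)) - ip h (w' r)).
      by apply/funext => r; rewrite /d ipB ipZ ipB.
    by apply: exp_integrableB => //; apply: exp_integrableZ; exact: exp_integrableB.
  have int_le : (\int[hl]_x `|expR (- l * x) *: d x|%:E <= C%:E * N t)%E.
    rewrite NE; apply: le_trans (CP d md); rewrite le_eqVlt; apply/orP; left.
    apply/eqP; apply: eq_integral => x _.
    by rewrite normrZ (ger0_norm (expR_ge0 _)).
  have Nge : (0 <= N t)%E by rewrite /N /LE_norm; exact: Lnorm_ge0.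
  rewrite -dl -abse_EFin laplaceE//.
  have med : weakly_measurable ip (fun x => expR (- l * x) *: d x).
    by apply: weakly_measurableZ => //; exact: measurable_expRM.
  under eq_integral do rewrite -ipZ.
  have := weak_integral_le (mu := hl) H_separable h med.
  move=> /(_ _)/le_trans; apply.
    by rewrite (le_lt_trans int_le)// lte_mul_pinfty ?lee_fin// fin_numE.
  by rewrite EFinM -muleA lee_wpmul2l// lee_fin.
have slope : t^-1 * (expR (- t * psi) - 1) @[t --> 0^'+] --> - psi.
  exact: cvg_exp_slope.
have lim1 : `|t^-1 * (expR (- t * psi) - 1) * A - B| @[t --> 0^'+] -->
    `|- psi * A - B|.
  apply: cvg_norm; apply: cvgB; last exact: cvg_cst.
  exact: cvgMr_tmp.
have lim2 : `|t^-1 * (expR (- t * psi) - 1) * A - B| @[t --> 0^'+] --> (0 : R).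
  have [Nfin _] := (fine_cvgP _ _).1 Dcvg.
  apply: (fine_cvg (f := fun t =>
    `|t^-1 * (expR (- t * psi) - 1) * A - B|%:E)).
  apply: (@squeeze_cvge _ _ _ _ (fun=> 0%E) _
    (fun t => (`|h| * C)%:E * N t)%E).
  - near=> t; rewrite lee_fin normr_ge0 /=; apply: bound.
      by near: t; exact: nbhs_right_gt.
    have : N t \is a fin_num by near: t.
    by rewrite fin_numE => /andP[_ Ny]; rewrite ltey.
  - exact: cvg_cst.
  - by rewrite -[X in _ --> X](mule0 (`|h| * C)%:E); apply: cvgeZl => //.
have : `|- psi * A - B| = 0.
  by rewrite -(cvg_lim _ lim1)// (cvg_lim _ lim2).
by move/normr0_eq0/subr0_eq.
Unshelve. all: by end_near. Qed.

End GeneratorLaplace.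

(** * The weak derivative of the convolution *)

Section WeakDerivativeOfConvolution.
Context {R : realType} {H : completeNormedModType R}.
Variable ip : inner_product H.
Hypothesis H_separable : separable_space H.
Local Notation hl := (@half_line R).
Implicit Types (u v f g w : R -> H).

Lemma test_function_bound (phi : R -> R) : test_function phi -> exists C : R,
  forall x, 0 <= x -> `|phi x| <= C * expR (- x) /\
    `|phi^`()%classic x| <= C * expR (- x).
Proof.
move=> tphi; have [n [c [d1 d0]]] := exp_sum_approx tphi (@ltr01 R).
have [C CP] := exp_sum_bound n c.
have [C' CP'] := exp_sum_bound n (fun i => i.+1%:R * c i).
exists (1 + Num.max C C') => x x0; have e0 := expR_ge0 (- x).
have Cm : C * expR (- x) <= Num.max C C' * expR (- x).
  by rewrite ler_wpM2r// le_max lexx.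
have Cm' : C' * expR (- x) <= Num.max C C' * expR (- x).
  by rewrite ler_wpM2r// le_max lexx orbT.
rewrite mulrDl; split.
  rewrite -[phi x](subrK (exp_sum n c x)) (le_trans (ler_normD _ _))//.
  by rewrite lerD ?d0// (le_trans (CP x x0)).
rewrite -[_^`()%classic x](addrK (exp_sum n (fun i => i.+1%:R * c i) x)).
rewrite (le_trans (ler_normB _ _))// lerD ?d1// (le_trans (CP' x x0))//.
Qed.

Lemma weighted_bochner_spec f g (psi : R -> R) C : exp_bochner ip g ->
  {ae hl, forall x, f x = g x} -> measurable_fun setT psi ->
  (forall x, 0 <= x -> `|psi x| <= C * expR (- x)) ->
  bochner_integrable hl (fun x => psi x *: f x) /\
  forall h, ip h (bochner hl (fun x => psi x *: f x)) =
    \int[hl]_x (psi x * ip h (g x)).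
Proof.
move=> ge fg mpsi psiC.
have [mpg pgfin] := weighted_bochner H_separable ge mpsi psiC.
have aefg : {ae hl, forall x, psi x *: f x = psi x *: g x}.
  by apply: filterS fg => x ->.
have [bint _ bip] := bochner_spec (mu := hl) H_separable mpg aefg pgfin.
split=> // h; rewrite /Rintegral.
by under [in RHS]eq_integral do rewrite -ipZ; rewrite -bip.
Qed.

Lemma exp_bochner_locally_integrable f g : exp_bochner ip g ->
  {ae hl, forall x, f x = g x} -> locally_bochner_integrable f.
Proof.
move=> ge fg T T0.
have mi : measurable_fun setT (\1_`[0, T] : R -> R).
  by apply: measurable_indic; exact: measurable_itv.
have iT x : 0 <= x -> `|\1_`[0, T] x : R| <= expR T * expR (- x).
  move=> x0; rewrite indicE mem_setE in_itv /= x0 /= -expRD.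
  case: (leP x T) => xT /=; last by rewrite normr0 expR_ge0.
  by rewrite normr1 -expR0 ler_expR subr_ge0.
by have [] := weighted_bochner_spec ge fg mi iT.
Qed.

Lemma weak_derivative_of_laplace f g v w : exp_bochner ip g ->
  {ae hl, forall x, f x = g x} -> exp_bochner ip v ->
  {ae hl, forall x, w x = v x} ->
  (forall l h, 1 <= l -> l * laplace l (fun x => ip h (g x)) =
    - laplace l (fun x => ip h (v x))) ->
  weak_derivative f (fun x => - w x).
Proof.
move=> ge fg ve wv gv; have [mv v0 vfin] := ve.
have nve : exp_bochner ip (fun x => (-1) *: v x).
  split; first by apply: (weakly_measurableZ (a := fun=> -1)).
    by move=> x /v0 ->; rewrite scaler0.
  by under eq_integral do rewrite scaleN1r normrN.
have nwv : {ae hl, forall x, - w x = (-1) *: v x}.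
  by apply: filterS wv => x ->; rewrite scaleN1r.
split; [exact: exp_bochner_locally_integrable fg|
        exact: exp_bochner_locally_integrable nwv|].
move=> phi tphi; have [C CP] := test_function_bound tphi.
have mphi : measurable_fun setT phi.
  by apply: continuous_measurable_fun; exact: continuous_test_function.
have mphi' : measurable_fun setT phi^`()%classic.
  by apply: continuous_measurable_fun; exact: continuous_derive1_test_function.
have [_ bf] := weighted_bochner_spec ge fg mphi' (fun x x0 => (CP x x0).2).
have [_ bw] := weighted_bochner_spec nve nwv mphi (fun x x0 => (CP x x0).1).
apply: (ip_eqP (ip := ip)) => h; rewrite ipN bf bw.
have gh := exp_integrable_ip H_separable h ge.
have vh := exp_integrable_ip H_separable h ve.
rewrite (laplace_weak_derivative gh vh _ tphi); last first.
  by move=> n; apply: gv; rewrite ler1n.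
rewrite -[RHS]mulN1r -RintegralZl//.
  congr fine; apply: eq_integral => x _; congr EFin.
  by rewrite ipZ; ring.
exact: (weighted_integrable (exp_integrable_ip H_separable h nve) mphi
  (fun x x0 => (CP x x0).1)).
Qed.

End WeakDerivativeOfConvolution.

Section TrivialApproximation.
Context {R : realType} {V H : completeNormedModType R}.
Variables (ip : inner_product H) (iota : {linear V -> H}).
Hypothesis iota_cont : continuous iota.

Lemma LE0 d (T : measurableType d) (E : normedModType R)
    (mu : {measure set T -> \bar R}) (p : R) : p != 0 ->
  LE_norm mu p (fun=> 0 : E) = 0%E /\ LE mu p (fun=> 0 : E).
Proof.
move=> p0; have N0 : LE_norm mu p (fun=> 0 : E) = 0%E.
  rewrite /LE_norm (_ : (fun x => _) = cst 0%E) ?Lnorm0//.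
  by apply/funext => x; rewrite normr0.
split => //; split; last by rewrite N0.
exists (fun=> [::]); split => [n p' //|].
by apply: aeW => x; rewrite /simple_val big_nil; exact: cvg_cst.
Qed.

Lemma H_to_dual0 : H_to_dual ip iota_cont 0 = 0.
Proof.
by apply/val_inj/funext => x /=; rewrite ipC ip0.
Qed.

(** Elements of the domain that lie in calV belong to the graph of the operator
    being closed, so that constant sequences witness the closure. *)
Lemma F_space_of_domain (alpha : R) mu (v : R -> V) : 1 < alpha ->
  dom_Lambda_H mu (iota \o v) -> calV iota alpha v ->
  F_space ip iota_cont alpha mu v.
Proof.
move=> a1 [w Lw] Vv; have [_ w2 _] := Lw.
have a0 : alpha != 0 by rewrite gt_eqF// (lt_trans ltr01).
have q0 : alpha / (alpha - 1) != 0.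
  by rewrite mulf_neq0// invr_eq0 subr_eq0 gt_eqF.
have two0 : 2 != 0 :> R by [].
have [N1 L1] := LE0 (dual V) (@half_line R) q0.
have [N2 L2] := LE0 H (@half_line R) two0.
exists (H_to_dual ip iota_cont \o w); split => //.
  exists (fun=> 0), w; split => //.
  by apply: aeW => t /=; rewrite add0r.
exists (fun=> v), (fun=> w); split => //.
  rewrite (_ : (fun n => _) = cst 0%E); first exact: cvg_cst.
  apply/funext => n; rewrite /calV_norm.
  have -> : v \- v = (fun=> 0) by apply/funext => x /=; rewrite subrr.
  have -> : iota \o (fun=> 0) = (fun=> 0) :> (R -> H).
    by apply/funext => x /=; rewrite linear0.
  have [-> _] := LE0 V (@half_line R) a0.
  by rewrite N2 maxxx.
rewrite (_ : (fun n => _) = cst 0%E); first exact: cvg_cst.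
apply/funext => n; apply/eqP; rewrite eq_le; apply/andP; split; last first.
  apply: le_ereal_inf_tmp => _ [g1 [g2 [_ ->]]].
  by rewrite adde_ge0// Lnorm_ge0.
apply: ereal_inf_lbound; exists (fun=> 0), (fun=> 0); split; last first.
  by rewrite N1 N2 adde0.
split => //; apply: aeW => t /=.
by rewrite H_to_dual0 addr0 subrr.
Qed.

End TrivialApproximation.

Theorem proposition3p2 (R : realType) (V H : completeNormedModType R)
  (ip : inner_product H) (H_separable : separable_space H)
  (V_reflexive : reflexive_space V)
  (iota : {linear V -> H}) (iota_cont : continuous iota)
  (iota_inj : injective iota) (iota_dense : dense (range iota))
  (alpha : R) (alpha_gt1 : 1 < alpha)
  (k : R -> R) (k_adm : admissible_kernel k)
  (M : {measure set (measurableTypeR R) -> \bar R})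
  (M_tail : tail_measure k M)
  (mu : R -> probability (measurableTypeR R) R)
  (mu_semigroup : convolution_semigroup M mu) :
  ([set v : R -> V | dom_Lambda_H mu (iota \o v)] `&` calV iota alpha `<=`
    F_space ip iota_cont alpha mu) /\
  (forall u w : R -> H, Lambda_H mu u w ->
    weak_derivative (causal_conv k u) (fun t => - w t)).
Proof.
split=> [v [/= dv Vv]|u w Luw]; first exact: F_space_of_domain.
have [Lu Lw _] := Luw.
have [u' [ue uu']] := exp_bochner_repr ip H_separable Lu.
have [w' [we ww']] := exp_bochner_repr ip H_separable Lw.
have [g [ge kg lg]] := causal_conv_repr H_separable k_adm ue uu'.
apply: (weak_derivative_of_laplace H_separable ge kg we ww') => l h l1.
rewrite lg// mulrA (laplace_kernel k_adm M_tail l1).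
rewrite (generator_laplace H_separable mu_semigroup Luw ue uu' we ww' h l1).
by rewrite mulNr opprK.
Qed.
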